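(* Let $\mathcal{H}$ be a complex separable infinite-dimensional Hilbert space and let $A$ be a non-zero positive bounded operator on $\mathcal{H}$ such that $R(A)$ is closed. Let $T\in\mathcal{B}_{A^{1/2}}(\mathcal{H})$ be such that $T=N+K$, where $N$ is $A$-normal and $K\in\mathcal{K}_{A^{1/2}}(\mathcal{H})$. If $W_A(T)\subseteq\overline{\mathbb{D}}$, $\sigma_{A_{ess}}(T)\subseteq\mathbb{D}$ and $\overline{W_A(T)}\cap\partial\mathbb{D}$ is an infinite set, then $W_A(T)=\overline{\mathbb{D}}$.
   Context: $\mathbb{D}=\{z\in\mathbb{C}:|z|<1\}$. $\mathcal{B}(\mathcal{H})$ is the algebra of bounded linear operators on $\mathcal{H}$; $A\in\mathcal{B}(\mathcal{H})$ is positive if $\langle Ax,x\rangle\ge 0$ for all $x$. $R(\cdot)$ denotes range. Put $\langle x,y\rangle_A=\langle Ax,y\rangle$ and $\|x\|_A=\langle x,x\rangle_A^{1/2}$. $\mathcal{B}_A(\mathcal{H})=\{T\in\mathcal{B}(\mathcal{H}): R(T^*A)\subseteq R(A)\}$. For $T\in\mathcal{B}_A(\mathcal{H})$, $T^{\sharp_A}$ is the unique $X\in\mathcal{B}(\mathcal{H})$ with $AX=T^*A$ and $R(X)\subseteq\overline{R(A)}$. An operator $N\in\mathcal{B}_A(\mathcal{H})$ is called $A$-normal if $AN^{\sharp_A}N=ANN^{\sharp_A}$. $\mathcal{B}_{A^{1/2}}(\mathcal{H})=\{T\in\mathcal{B}(\mathcal{H}): \exists c>0,\ \|Tx\|_A\le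 c\|x\|_A\ \forall x\in\mathcal{H}\}$ (it contains $\mathcal{B}_A(\mathcal{H})$). $\mathcal{K}_{A^{1/2}}(\mathcal{H})$ is the set of $A$-compact operators: $K\in\mathcal{B}_{A^{1/2}}(\mathcal{H})$ is $A$-compact if for every sequence $(x_n)$ in $\mathcal{H}$ with $\sup_n\|x_n\|_A<\infty$, the sequence $(Kx_n)$ has a subsequence converging in the semi-norm $\|\cdot\|_A$ to an element of $\mathcal{H}$. $T\in\mathcal{B}_{A^{1/2}}(\mathcal{H})$ is $A$-Fredholm if there exist $S\in\mathcal{B}_{A^{1/2}}(\mathcal{H})$ and $K_1,K_2\in\mathcal{K}_{A^{1/2}}(\mathcal{H})$ with $ATS-A=AK_1$ and $AST-A=AK_2$. The $A$-essential spectrum is $\sigma_{A_{ess}}(T)=\{\lambda\in\mathbb{C}: T-\lambda I\text{ is not }A\text{-Fredholm}\}$. The $A$-numerical range is $W_A(T)=\{\langle Tx,x\rangle_A: x\in\mathcal{H},\ \|x\|_A=1\}$. *)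

(* Defs.v *)
From HB Require Import structures.
From mathcomp Require Import all_boot all_order all_algebra.
From mathcomp Require Import complex.
From mathcomp Require Import all_classical all_reals all_analysis.

Set Implicit Arguments.
Unset Strict Implicit.
Unset Printing Implicit Defensive.

Import Order.TTheory GRing.Theory Num.Theory.
Import numFieldNormedType.Exports.

Local Open Scope classical_set_scope.
Local Open Scope complex_scope.
Local Open Scope ring_scope.

(* Scalars are [R[i]] with [R : realType]. Norms take values in [R[i]], where
   [0 <= z] and [z <= w] entail that [z], resp. [w - z], is real. The topology
   of the complex plane is the one of the regular module [R[i]^o]. Operators
   are plain functions [H -> H]; [bounded_op] carries linearity. *)

Section Plane.
Variable R : realType.

Definition unit_disc : set R[i]^o := [set z | `|z| < 1].

Definition boundary (S : set R[i]^o) : set R[i]^o := closure S `\` interior S.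

End Plane.

Section HilbertSpace.
Variables (R : realType) (H : completeNormedModType R[i]).

(* A complete normed module is a Hilbert space when its norm comes from an
   inner product, here linear in the first argument. *)
Definition induces_norm (ip : {dot H for @Num.conj R[i]}) : Prop :=
  forall x, `|x| ^+ 2 = ip x x.

Definition separable : Prop := exists D : set H, countable D /\ dense D.

Definition infinite_dimensional : Prop :=
  ~ exists (n : nat) (e : 'I_n -> H),
      forall x, exists c : 'I_n -> R[i], x = \sum_i c i *: e i.

Definition bounded_op (T : H -> H) : Prop :=
  linear T /\ exists M : R[i], forall x, `|T x| <= M * `|x|.

End HilbertSpace.

Section SemiHilbertSpace.
Variables (R : realType) (H : completeNormedModType R[i]).
Variable ip : {dot H for @Num.conj R[i]}.

Definition positive_op (A : H -> H) : Prop :=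
  bounded_op A /\ forall x, 0 <= ip (A x) x.

Definition is_adjoint (T Tstar : H -> H) : Prop :=
  bounded_op Tstar /\ forall x y, ip (T x) y = ip x (Tstar y).

Variable A : H -> H.

Definition ipA (x y : H) : R[i] := ip (A x) y.

Definition normA (x : H) : R[i] := sqrtC (ipA x x).

Definition in_BA (T : H -> H) : Prop :=
  bounded_op T /\
  exists Tstar, is_adjoint T Tstar /\ range (Tstar \o A) `<=` range A.

(* [X] is the A-adjoint of [T]. *)
Definition is_sharp (T X : H -> H) : Prop :=
  [/\ bounded_op X,
      exists Tstar, is_adjoint T Tstar /\ A \o X = Tstar \o A &
      range X `<=` closure (range A)].

Definition A_normal (N : H -> H) : Prop :=
  in_BA N /\
  exists Nsharp, is_sharp N Nsharp /\ A \o Nsharp \o N = A \o N \o Nsharp.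

Definition in_BA12 (T : H -> H) : Prop :=
  bounded_op T /\
  exists c : R[i], 0 < c /\ forall x, normA (T x) <= c * normA x.

Definition A_compact (K : H -> H) : Prop :=
  in_BA12 K /\
  forall x : nat -> H, (exists M : R[i], forall n, normA (x n) <= M) ->
    exists (f : nat -> nat) (y : H),
      (forall m n, (m < n)%N -> (f m < f n)%N) /\
      ((fun n => normA (K (x (f n)) - y) : R[i]^o) @ \oo --> (0 : R[i]^o)).

Definition A_Fredholm (T : H -> H) : Prop :=
  in_BA12 T /\
  exists S K1 K2 : H -> H,
    [/\ in_BA12 S, A_compact K1, A_compact K2,
        forall x, A (T (S x)) - A x = A (K1 x) &
        forall x, A (S (T x)) - A x = A (K2 x)].

Definition A_ess_spectrum (T : H -> H) : set R[i]^o :=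
  [set lambda : R[i]^o | ~ A_Fredholm (fun x => T x - (lambda : R[i]) *: x)].

Definition A_numerical_range (T : H -> H) : set R[i]^o :=
  [set z | exists x : H, normA x = 1 /\ z = ipA (T x) x].

End SemiHilbertSpace.

(* Main.v *)
(* Work with the semi-inner product <x, y>_A, which is complete because R(A) is
   closed. For z on the unit circle let h_z be the form of 1 - Re (z^-1 T); it
   is nonnegative, and z lies in W_A(T) exactly when h_z vanishes at a unit
   vector. Since all points outside the open disc are Fredholm, the normal part
   N is a strict contraction on the orthogonal of some finite set (otherwise N
   has approximate eigenvectors there for some l with |l| >= 1), and K is small
   there; so h_z becomes uniformly coercive after adding a fixed finite rank
   projection. As z h_z is polynomial in z on the circle, whether h_z has a
   kernel is decided by a determinant that has power series expansions along the
   circle, and this determinant also vanishes at every contact point of the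
   closure of W_A(T). Infinitely many contact points force it to vanish
   identically, so the whole circle lies in W_A(T), and convexity
   (Toeplitz-Hausdorff) gives the closed disc. *)
Require Import Defs.
From HB Require Import structures.
From mathcomp Require Import all_boot all_order all_algebra.
From mathcomp Require Import complex ring lra.
From mathcomp Require Import all_classical all_reals all_analysis.
Import Order.TTheory GRing.Theory Num.Theory.
Import numFieldNormedType.Exports.
Import Normc.
Local Open Scope classical_set_scope.
Local Open Scope complex_scope.
Local Open Scope ring_scope.
Local Notation Re := complex.Re.
Local Notation Im := complex.Im.
Set Implicit Arguments.
Unset Strict Implicit.
Unset Printing Implicit Defensive.

(** * The complex modulus and semi-inner products *)

(** The form has null vectors and no quotient is taken: vectors are compared through
    [nm (x - y) = 0], and by Cauchy-Schwarz the form does not see null vectors. Two classical tools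
    get elementary substitutes. Instead of a spectral theorem for N with A-adjoint N', an essential
    supremum of the form of N'N, followed by one of the form of (N + N')/2 among approximate
    eigenvectors of N'N, yields l with |l| >= 1 such that N cannot be bounded below both at l and at
    its conjugate. Instead of complex analysis, analyticity means Taylor estimates at points of the
    circle only, with constants uniform in the centre; the identity principle then travels round the
    circle in equal short steps. Contact points of the closure need not be values of the form, so
    the determinant needs a quantitative converse: where it is nonzero, h_z dominates a positive
    multiple of the squared semi-norm, which keeps z at a positive distance from W_A(T). *)

Section ComplexModulus.
Variable R : realType.
Implicit Types (a b z w : R[i]) (r : R).

Lemma normcE_norm z : `|z| = (normc z)%:C. Proof. by []. Qed.

Lemma normc_ge0 z : 0 <= normc z.
Proof. by case: z => a b; exact: sqrtr_ge0. Qed.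

Lemma normcD_le z w : normc (z + w) <= normc z + normc w.
Proof. exact: le_normcD. Qed.

Lemma normcN_eq z : normc (- z) = normc z.
Proof. exact: normcN. Qed.

Lemma normcB_le z w : normc (z - w) <= normc z + normc w.
Proof. by rewrite -(normcN_eq w) normcD_le. Qed.

Lemma normcX z n : normc (z ^+ n) = normc z ^+ n.
Proof.
by elim: n => [|n IHn]; rewrite ?expr0 ?normc1 // !exprS normcM IHn.
Qed.

Lemma normcC r : normc r%:C = `|r|.
Proof. by rewrite /= expr0n addr0 sqrtr_sqr. Qed.

Lemma normc_conj z : normc z^* = normc z.
Proof. by case: z => a b /=; rewrite sqrrN. Qed.

Lemma normc_sqr z : normc z ^+ 2 = Re z ^+ 2 + Im z ^+ 2.
Proof. by case: z => a b /=; rewrite sqr_sqrtr // addr_ge0 ?sqr_ge0. Qed.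

Lemma normc_eq0 z : (normc z == 0) = (z == 0).
Proof.
by apply/eqP/eqP => [/eq0_normc|->]; rewrite ?normc0.
Qed.

Lemma mulc_conj z : z * z^* = (normc z ^+ 2)%:C.
Proof.
rewrite normc_sqr; case: z => a b /=.
by apply/eqP; rewrite eq_complex /=; apply/andP; split; apply/eqP; ring.
Qed.

Lemma Re_le_normc z : Re z <= normc z.
Proof.
have := normc_sqr z; have := normc_ge0 z; have := sqr_ge0 (Im z).
move: (Re z) (normc z) => x n; nra.
Qed.

Lemma normc_Re_ge z : - normc z <= Re z.
Proof.
have := Re_le_normc (- z); rewrite normcN_eq.
by case: z => a b /=; lra.
Qed.

Lemma ReD z w : Re (z + w) = Re z + Re w. Proof. by case: z; case: w. Qed.
Lemma ReN z : Re (- z) = - Re z. Proof. by case: z. Qed.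
Lemma ReB z w : Re (z - w) = Re z - Re w. Proof. by rewrite ReD ReN. Qed.
Lemma ReCM r z : Re (r%:C * z) = r * Re z.
Proof. by case: z => a b /=; rewrite mul0r subr0. Qed.
Lemma ReJ z : Re z^* = Re z. Proof. by case: z. Qed.

Lemma conjcM z w : (z * w)^* = z^* * w^*. Proof. exact: rmorphM. Qed.
Lemma conjcD z w : (z + w)^* = z^* + w^*. Proof. exact: rmorphD. Qed.
Lemma conjcN z : (- z)^* = - z^*. Proof. exact: rmorphN. Qed.
Lemma conjcB z w : (z - w)^* = z^* - w^*. Proof. exact: rmorphB. Qed.

Lemma conj_realC r : (r%:C)^* = r%:C.
Proof. by rewrite -[LHS]/(r -i* 0)%C oppr0. Qed.

Lemma unit_conj z : normc z = 1 -> z * z^* = 1.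
Proof. by rewrite mulc_conj => ->; rewrite expr1n. Qed.

Lemma complex_ext z w : Re z = Re w -> Im z = Im w -> z = w.
Proof. by case: z => a b; case: w => c d /= -> ->. Qed.

Lemma sum_normc_le (I : Type) (s : seq I) (f : I -> R[i]) :
  normc (\sum_(i <- s) f i) <= \sum_(i <- s) normc (f i).
Proof.
elim/big_rec2: _ => [|i y x _ IH]; first by rewrite normc0.
by apply: le_trans (normcD_le _ _) _; rewrite lerD2l.
Qed.

End ComplexModulus.

(** * Semi-inner products: Cauchy-Schwarz, Riesz representation, adjoints *)

Section SemiInner.
Variables (R : realType) (V : lmodType R[i]).
Implicit Types (x y z : V) (a b c : R[i]) (r : R).

Record semi_inner (g : V -> V -> R[i]) : Prop := SemiInner {
  semi_linear : forall a x y z, g (a *: x + y) z = a * g x z + g y z;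
  semi_conj : forall x y, g y x = (g x y)^*;
  semi_ge0 : forall x, 0 <= g x x }.

Definition snm (g : V -> V -> R[i]) x : R := Num.sqrt (Re (g x x)).

Definition nm_complete (g : V -> V -> R[i]) : Prop :=
  forall u : nat -> V,
    (forall e, 0 < e -> exists n0, forall m n, (n0 <= m)%N -> (n0 <= n)%N ->
       snm g (u m - u n) <= e) ->
    exists x, forall e, 0 < e -> exists n0, forall n, (n0 <= n)%N ->
       snm g (u n - x) <= e.

Definition lin (T : V -> V) := forall a x y, T (a *: x + y) = a *: T x + T y.

Definition bdd (g : V -> V -> R[i]) (T : V -> V) :=
  exists2 c : R, 0 <= c & forall x, snm g (T x) <= c * snm g x.

Section Lin.
Variables (T : V -> V) (Tlin : lin T).
Lemma lin0 : T 0 = 0.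
Proof. by have := Tlin (-1) 0 0; rewrite !scaleN1r !addNr. Qed.
Lemma linD x y : T (x + y) = T x + T y.
Proof. by have := Tlin 1 x y; rewrite !scale1r. Qed.
Lemma linZ a x : T (a *: x) = a *: T x.
Proof. by have := Tlin a x 0; rewrite lin0 !addr0. Qed.
Lemma linN x : T (- x) = - T x.
Proof. by rewrite -scaleN1r linZ scaleN1r. Qed.
Lemma linB x y : T (x - y) = T x - T y.
Proof. by rewrite linD linN. Qed.
End Lin.

Lemma lin_shift (T : V -> V) a : lin T -> lin (fun x => T x - a *: x).
Proof.
move=> Tl b x y; rewrite Tl scalerBr scalerDr !scalerA (mulrC a b).
by rewrite opprD addrACA.
Qed.

Variables (g : V -> V -> R[i]) (gP : semi_inner g).

Local Notation nm := (snm g).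

Lemma gPl a x y z : g (a *: x + y) z = a * g x z + g y z.
Proof. exact: semi_linear. Qed.
Lemma gC x y : g y x = (g x y)^*. Proof. exact: semi_conj. Qed.
Lemma gDl x y z : g (x + y) z = g x z + g y z.
Proof. by have := gPl 1 x y z; rewrite scale1r mul1r. Qed.
Lemma g0l z : g 0 z = 0.
Proof. by have := gPl (-1) 0 0 z; rewrite scaler0 addr0 mulN1r addNr. Qed.
Lemma gZl a x z : g (a *: x) z = a * g x z.
Proof. by have := gPl a x 0 z; rewrite addr0 g0l addr0. Qed.
Lemma gNl x z : g (- x) z = - g x z.
Proof. by rewrite -scaleN1r gZl mulN1r. Qed.
Lemma gBl x y z : g (x - y) z = g x z - g y z.
Proof. by rewrite gDl gNl. Qed.
Lemma gDr x y z : g x (y + z) = g x y + g x z.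
Proof. by rewrite gC gDl conjcD -!gC. Qed.
Lemma gZr a x z : g x (a *: z) = a^* * g x z.
Proof. by rewrite gC gZl conjcM -gC. Qed.
Lemma g0r z : g z 0 = 0. Proof. by rewrite gC g0l conjC0. Qed.
Lemma gNr x z : g x (- z) = - g x z.
Proof. by rewrite gC gNl conjcN -gC. Qed.
Lemma gBr x y z : g x (y - z) = g x y - g x z.
Proof. by rewrite gDr gNr. Qed.
Lemma g_suml (I : Type) (s : seq I) (f : I -> V) z :
  g (\sum_(i <- s) f i) z = \sum_(i <- s) g (f i) z.
Proof. by apply: (big_morph (g ^~ z)) => [x y|]; rewrite ?gDl ?g0l. Qed.

Lemma nm_ge0 x : 0 <= nm x. Proof. exact: sqrtr_ge0. Qed.

Lemma Re_gxx_ge0 x : 0 <= Re (g x x).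
Proof. by have := semi_ge0 gP x; rewrite lecE => /andP[]. Qed.

Lemma nm_sqr x : nm x ^+ 2 = Re (g x x).
Proof. exact: (sqr_sqrtr (Re_gxx_ge0 x)). Qed.

Lemma gxxE x : g x x = (nm x ^+ 2)%:C.
Proof.
rewrite nm_sqr; apply: complex_ext => //=.
exact: ger0_Im (semi_ge0 gP x).
Qed.

Lemma nm_sqrD x y : nm (x + y) ^+ 2 = nm x ^+ 2 + 2 * Re (g x y) + nm y ^+ 2.
Proof.
rewrite !nm_sqr gDl !gDr !ReD (gC x y) ReJ; ring.
Qed.

Lemma nmZ a x : nm (a *: x) = normc a * nm x.
Proof.
apply: (@pexpIrn _ 2) => //; rewrite ?nnegrE ?mulr_ge0 ?nm_ge0 ?normc_ge0 //.
by rewrite exprMn nm_sqr gZl gZr mulrA mulc_conj ReCM -nm_sqr.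
Qed.

Lemma nmN x : nm (- x) = nm x.
Proof. by rewrite -scaleN1r nmZ normcN_eq normc1 mul1r. Qed.

Lemma nm_distC x y : nm (x - y) = nm (y - x).
Proof. by rewrite -nmN opprB. Qed.

Lemma nm0 : nm 0 = 0.
Proof. by rewrite -(scale0r 0) nmZ normc0 mul0r. Qed.

Lemma nm_sqrB x y : nm (x - y) ^+ 2 = nm x ^+ 2 - 2 * Re (g x y) + nm y ^+ 2.
Proof. by rewrite nm_sqrD gNr ReN nmN mulrN. Qed.

Lemma cauchy_schwarz x y : normc (g x y) <= nm x * nm y.
Proof.
set p := normc (g x y).
have key s : 0 <= nm x ^+ 2 - 2 * s * p ^+ 2 + s ^+ 2 * p ^+ 2 * nm y ^+ 2.
  have := sqr_ge0 (nm (x - (s%:C * g x y) *: y)).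
  rewrite nm_sqrB nmZ normcM normcC -/p !exprMn real_normK ?num_real //.
  rewrite gZr conjcM conj_realC -mulrA ReCM mulrC.
  rewrite [X in Re X]mulrC mulc_conj /= -/p.
  by move=> h; apply: le_trans h _; rewrite -mulrA le_eqVlt; apply/orP; left; apply/eqP; ring.
have p0 : 0 <= p := normc_ge0 _.
have x0 := nm_ge0 x; have y0 := nm_ge0 y.
rewrite -ler_sqr ?nnegrE ?mulr_ge0 // exprMn.
have [y1|y1] := eqVneq (nm y) 0.
  rewrite y1 expr0n mulr0.
  have [->|pn0] := eqVneq p 0; first by rewrite expr0n.
  have pp : 0 < p ^+ 2 by rewrite exprn_even_gt0.
  (* With [nm y = 0] the bound [key] is affine in s, and this s gives it the value -1. *)
  have := key ((nm x ^+ 2 + 1) / p ^+ 2 / 2).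
  rewrite y1 expr0n mulr0 addr0.
  have -> : 2 * ((nm x ^+ 2 + 1) / p ^+ 2 / 2) * p ^+ 2 = nm x ^+ 2 + 1.
    by field; exact: pn0.
  lra.
have yp : 0 < nm y ^+ 2 by rewrite exprn_even_gt0.
have := key (nm y ^+ 2)^-1.
have -> : nm x ^+ 2 - 2 * (nm y ^+ 2)^-1 * p ^+ 2 +
  (nm y ^+ 2)^-1 ^+ 2 * p ^+ 2 * nm y ^+ 2 = nm x ^+ 2 - p ^+ 2 / nm y ^+ 2.
  by field.
by rewrite subr_ge0 ler_pdivrMr.
Qed.

Lemma nmD_le x y : nm (x + y) <= nm x + nm y.
Proof.
rewrite -ler_sqr ?nnegrE ?addr_ge0 ?nm_ge0 // nm_sqrD.
have := cauchy_schwarz x y; have := Re_le_normc (g x y); nra.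
Qed.

Lemma nmB_le x y : nm (x - y) <= nm x + nm y.
Proof. by rewrite -(nmN y) nmD_le. Qed.

Lemma nm_sum_le (I : Type) (s : seq I) (f : I -> V) :
  nm (\sum_(i <- s) f i) <= \sum_(i <- s) nm (f i).
Proof.
elim/big_rec2: _ => [|i y x _ IH]; first by rewrite nm0.
by apply: le_trans (nmD_le _ _) _; rewrite lerD2l.
Qed.

Lemma g_null x y : nm x = 0 -> g x y = 0.
Proof.
move=> x0; apply/eqP; rewrite -normc_eq0 eq_le normc_ge0 andbT.
by have := cauchy_schwarz x y; rewrite x0 mul0r.
Qed.

Lemma nm_null x : (forall y, g x y = 0) -> nm x = 0.
Proof. by move=> h; rewrite /snm h /= sqrtr0. Qed.

Lemma nm_eq_of_null x y : nm (x - y) = 0 -> nm x = nm y.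
Proof.
move=> h; have h1 := nmD_le (x - y) y; have h2 := nmB_le x (x - y).
move: h1 h2; rewrite subrK subKr h; lra.
Qed.

(* Minimise [|x|^2 - 2 Re (phi x)]; minimising sequences are Cauchy by the
   parallelogram identity. *)
Lemma riesz (phi : V -> R[i]) (c : R) : nm_complete g ->
  (forall a x y, phi (a *: x + y) = a^* * phi x + phi y) ->
  (forall x, normc (phi x) <= c * nm x) ->
  exists x, forall y, g x y = phi y.
Proof.
move=> gcomp phil phib.
have phiD x y : phi (x + y) = phi x + phi y.
  by have := phil 1 x y; rewrite scale1r conjC1 mul1r.
have phi0 : phi 0 = 0.
  by have := phil (-1) 0 0; rewrite scaler0 addr0 conjcN conjC1 mulN1r addNr.
have phiZ a x : phi (a *: x) = a^* * phi x.
  by have := phil a x 0; rewrite !addr0 phi0 addr0.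
pose J x := nm x ^+ 2 - 2 * Re (phi x).
have Jlb x : - c ^+ 2 <= J x.
  rewrite /J; have := phib x; have := Re_le_normc (phi x).
  have := sqr_ge0 (nm x - c); rewrite sqrrB; lra.
pose S := [set J x | x in setT].
have Sne : S !=set0 by exists (J 0), 0.
have Slb : has_lbound S by exists (- c ^+ 2) => _ [x _ <-].
have Sinf : has_inf S by [].
pose m := inf S.
have mle x : m <= J x by apply: ge_inf => //; exists x.
have apx n : exists x, J x <= m + n.+1%:R^-1.
  have n0 : 0 < n.+1%:R^-1 :> R by rewrite invr_gt0.
  by have [_ [x _ <-] /ltW h] := inf_adherent n0 Sinf; exists x.
have [u uP] := choice apx.
have half x y : 2 * J x + 2 * J y - 4 * J (2^-1 *: (x + y)) = nm (x - y) ^+ 2.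
  have e2 : (2^-1 : R[i]) = (2^-1 : R)%:C by rewrite fmorphV rmorph_nat.
  rewrite /J nmZ phiZ phiD e2 conj_realC ReCM ReD normcC exprMn.
  rewrite nm_sqrB nm_sqrD real_normK ?num_real //.
  by field.
have dist j k : nm (u j - u k) ^+ 2 <= 2 * j.+1%:R^-1 + 2 * k.+1%:R^-1.
  have := half (u j) (u k); have := mle (2^-1 *: (u j + u k)).
  have := uP j; have := uP k.
  move: (J _) (J _) (J _) j.+1%:R^-1 k.+1%:R^-1 => p q r s t; lra.
have [x xP] : exists x, forall e, 0 < e ->
    exists n0, forall n, (n0 <= n)%N -> nm (u n - x) <= e.
  apply: gcomp => e e0.
  have e20 : 0 < e ^+ 2 / 4 by rewrite divr_gt0 // exprn_gt0.
  have [n0 n0P] : exists n0 : nat, n0.+1%:R^-1 <= e ^+ 2 / 4.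
    exists (Num.truncn (e ^+ 2 / 4)^-1).
    rewrite invf_ple ?posrE //; apply: ltW; exact: truncnS_gt.
  have mono k : (n0 <= k)%N -> k.+1%:R^-1 <= e ^+ 2 / 4.
    by move=> nk; apply: le_trans n0P; rewrite lef_pV2 ?posrE // ler_nat.
  exists n0 => j k /mono hj /mono hk.
  rewrite -ler_sqr ?nnegrE ?nm_ge0 ?(ltW e0) //.
  move: hj hk (dist j k).
  move: (nm _ ^+ 2) (e ^+ 2) j.+1%:R^-1 k.+1%:R^-1 => p q r t; lra.
have Jm : J x <= m.
  have c0 : 0 <= `|c| by [].
  (* [J] varies little between [u n] and the limit [x], so [x] attains the infimum. *)
  have Jcont n : J x <= J (u n) + (2 * nm (u n) + nm (u n - x) + 2 * `|c|) * nm (u n - x).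
    pose d := u n - x; rewrite -/d.
    have -> : J x = nm (u n - d) ^+ 2 - 2 * Re (phi (u n - d)).
      by rewrite /J /d subKr.
    rewrite nm_sqrB.
    have -> : phi (u n - d) = phi (u n) - phi d.
      by rewrite phiD -scaleN1r phiZ conjcN conjC1 mulN1r.
    rewrite ReB /J.
    have := cauchy_schwarz (u n) d; have := normc_Re_ge (g (u n) d).
    have := phib d; have := Re_le_normc (phi d); have := nm_ge0 d.
    have := ler_norm c; nra.
  apply/ler_addgt0Pr => e e0.
  (* [B] dominates the factor in [Jcont] as soon as [u n] is within 1 of [x]. *)
  pose B := 2 * (nm x + 1) + 1 + 2 * `|c|.
  have B0 : 0 < B by rewrite /B; have := nm_ge0 x; lra.
  pose e' := Num.min 1 (e / (2 * B)).
  have e'0 : 0 < e' by rewrite lt_min ltr01 divr_gt0 // mulr_gt0.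
  have [n1 n1P] := xP _ e'0.
  pose n2 := Num.truncn (e / 2)^-1.
  have n2P : n2.+1%:R^-1 <= e / 2.
    by rewrite invf_ple ?posrE ?divr_gt0 //; apply: ltW; exact: truncnS_gt.
  pose n := maxn n1 n2.
  have hn2 : n.+1%:R^-1 <= e / 2.
    by apply: le_trans n2P; rewrite lef_pV2 ?posrE // ler_nat ltnS leq_maxr.
  have := n1P n (leq_maxl _ _); rewrite le_min => /andP[d1 d2].
  have d3 : B * nm (u n - x) <= e / 2.
    by move: d2; rewrite ler_pdivlMr ?mulr_gt0 //; lra.
  have d4 : nm (u n) <= nm x + 1.
    by have := nmD_le (u n - x) x; rewrite subrK; lra.
  have := le_trans (uP n) (lerD (lexx m) hn2).
  have := Jcont n; have := nm_ge0 (u n - x).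
  move: d3 d1 d4 c0; rewrite /B.
  move: (J _) (J _) (nm _) (nm _) (nm _) => p q r t v; nra.
exists x => y.
pose w := g x y - phi y.
(* Minimality of [x] against the variation [x + s w y]. *)
have key s : 0 <= 2 * s * normc w ^+ 2 + s ^+ 2 * normc w ^+ 2 * nm y ^+ 2.
  have := le_trans Jm (mle (x + (s%:C * w) *: y)).
  rewrite /J nm_sqrD phiD phiZ gZr ReD nmZ !conjcM conj_realC -!mulrA !ReCM.
  have -> : Re (w^* * g x y) = normc w ^+ 2 + Re (w^* * phi y).
    by rewrite -[g x y](subrK (phi y)) -/w mulrDr ReD mulrC mulc_conj.
  rewrite normcM normcC !exprMn real_normK ?num_real //; lra.
have : w = 0.
  apply/eqP; rewrite -normc_eq0; apply/negP => /negP w0.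
  have wp : 0 < normc w ^+ 2 by rewrite exprn_even_gt0.
  have y0 := sqr_ge0 (nm y).
  (* For this negative s the linear term outweighs the quadratic one, unless [w = 0]. *)
  have := key (- (nm y ^+ 2 + 1)^-1).
  move: (nm y ^+ 2) (normc w ^+ 2) y0 wp => q p y0 wp.
  have q1 : 0 < q + 1 by lra.
  have -> : 2 * - (q + 1)^-1 * p + (- (q + 1)^-1) ^+ 2 * p * q =
    - (p * (q + 2) / (q + 1) ^+ 2) by field; rewrite gt_eqF.
  rewrite oppr_ge0 leNgt divr_gt0 ?exprn_gt0 ?mulr_gt0 //; lra.
by move/eqP; rewrite subr_eq0 => /eqP.
Qed.

Lemma adjoint_exists (T : V -> V) : nm_complete g -> lin T -> bdd g T ->
  exists T', forall x y, g (T x) y = g x (T' y).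
Proof.
move=> gcomp Tl [c c0 Tb].
have h y : exists z, forall x, g z x = g y (T x).
  apply: (riesz (c := nm y * c)) => // [a x w|x].
    by rewrite Tl gDr gZr.
  apply: le_trans (cauchy_schwarz _ _) _; rewrite -mulrA.
  by apply: ler_wpM2l (Tb x); exact: nm_ge0.
have [T' T'P] := choice h.
by exists T' => x y; rewrite gC -T'P -gC.
Qed.

End SemiInner.

(** * Analytic functions on the unit circle *)

Section CircleAnalytic.
Variable R : realType.
Implicit Types (z w u v : R[i]) (f h : R[i] -> R[i]) (C M e : R).

(* Power series expansions at every point of the unit circle, with
   constants that do not depend on the point. *)
Definition circle_expansion f C M : Prop := forall z0, normc z0 = 1 ->
  exists a : nat -> R[i], (forall k, normc (a k) <= C * M ^+ k) /\
    forall z, normc z = 1 -> forall n,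
      normc (f z - \sum_(k < n) a k * (z - z0) ^+ k)
        <= C * (M * normc (z - z0)) ^+ n.

Definition circle_analytic f : Prop :=
  exists C M, [/\ 0 <= C, 1 <= M & circle_expansion f C M].

Lemma circle_expansion_mono f C M C' M' : 0 <= C -> 0 <= M ->
  C <= C' -> M <= M' -> circle_expansion f C M -> circle_expansion f C' M'.
Proof.
move=> C0 M0 CC MM fP z0 z01; have [a [ab aP]] := fP _ z01.
exists a; split=> [k|z z1 n].
  apply: le_trans (ab k) _; apply: ler_pM => //; first exact: exprn_ge0.
  by rewrite lerXn2r ?nnegrE // (le_trans M0).
apply: le_trans (aP _ z1 n) _; apply: ler_pM => //.
  by rewrite exprn_ge0 // mulr_ge0 // normc_ge0.
rewrite lerXn2r ?nnegrE ?mulr_ge0 ?normc_ge0 ?(le_trans M0) //.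
by rewrite ler_wpM2r ?normc_ge0.
Qed.

Lemma circle_analytic_ext f h : (forall z, normc z = 1 -> f z = h z) ->
  circle_analytic f -> circle_analytic h.
Proof.
move=> fh [C [M [C0 M1 fP]]]; exists C, M; split=> // z0 /fP [a [ab aP]].
by exists a; split=> // z z1 n; rewrite -fh //; exact: aP.
Qed.

Lemma circle_analytic_cst c : circle_analytic (fun=> c).
Proof.
exists (normc c), 1; split; rewrite ?normc_ge0 // => z0 _.
exists (fun k => if k is 0%N then c else 0); split=> [[|k]|z _ [|n]].
- by rewrite expr0 mulr1.
- by rewrite normc0 mulr_ge0 ?normc_ge0 ?exprn_ge0.
- by rewrite big_ord0 subr0 expr0 mulr1.
rewrite big_ord_recl big1 => [|i _]; last by rewrite mul0r.
by rewrite expr0 mulr1 addr0 subrr normc0 mulr_ge0 ?exprn_ge0 ?mulr_ge0 ?normc_ge0.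
Qed.

Lemma circle_analytic_id : circle_analytic id.
Proof.
exists 1, 1; split=> // z0 z01.
exists (fun k => match k with 0%N => z0 | 1%N => 1 | _ => 0 end).
split=> [[|[|k]]|z z1 [|[|n]]].
- by rewrite z01 mulr1.
- by rewrite normc1 mulr1.
- by rewrite normc0 mul1r exprn_ge0.
- by rewrite big_ord0 subr0 z1 mulr1.
- by rewrite big_ord1 expr0 mulr1 expr1 !mul1r.
rewrite !big_ord_recl /= big1 => [|i _]; last by rewrite mul0r.
rewrite expr0 mulr1 expr1 mul1r addr0 [z0 + _]addrC subrK subrr normc0.
by rewrite mulr_ge0 ?exprn_ge0 ?mulr_ge0 ?normc_ge0.
Qed.

Lemma circle_analyticD f h : circle_analytic f -> circle_analytic h ->
  circle_analytic (fun z => f z + h z).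
Proof.
move=> [C [M [C0 M1 fP]]] [C' [M' [C'0 M'1 hP]]].
have m0 : 0 <= M := le_trans ler01 M1; have m'0 : 0 <= M' := le_trans ler01 M'1.
pose N := Num.max M M'.
have MN : M <= N by rewrite le_max lexx.
have M'N : M' <= N by rewrite le_max lexx orbT.
have {}fP := circle_expansion_mono C0 m0 (lexx C) MN fP.
have {}hP := circle_expansion_mono C'0 m'0 (lexx C') M'N hP.
exists (C + C'), N; split; rewrite ?addr_ge0 ?(le_trans M1) //.
move=> z0 z01; have [a [ab aP]] := fP _ z01; have [b [bb bP]] := hP _ z01.
exists (fun k => a k + b k); split=> [k|z z1 n].
  by apply: le_trans (normcD_le _ _) _; rewrite mulrDl lerD.
under eq_bigr do rewrite mulrDl.
rewrite big_split /= opprD addrACA.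
apply: le_trans (normcD_le _ _) _.
by rewrite mulrDl lerD ?aP ?bP.
Qed.

(** Cauchy product: the coefficient of index k has k + 1 terms, and the factor k + 1 <= 2^k is
    absorbed by doubling the growth rate. *)
Lemma circle_analyticM f h : circle_analytic f -> circle_analytic h ->
  circle_analytic (fun z => f z * h z).
Proof.
move=> [C [M [C0 M1 fP]]] [C' [M' [C'0 M'1 hP]]].
have m0 : 0 <= M := le_trans ler01 M1; have m'0 : 0 <= M' := le_trans ler01 M'1.
pose N := Num.max M M'.
have MN : M <= N by rewrite le_max lexx.
have M'N : M' <= N by rewrite le_max lexx orbT.
have {}fP := circle_expansion_mono C0 m0 (lexx C) MN fP.
have {}hP := circle_expansion_mono C'0 m'0 (lexx C') M'N hP.
have n0 : 0 <= N by apply: le_trans m0 MN.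
have small n : n.+1%:R <= 2 ^+ n :> R.
  by rewrite -natrX ler_nat ltn_expl.
exists (C * C'), (2 * N); split; rewrite ?mulr_ge0 //.
  by have := le_trans M1 MN; lra.
move=> z0 z01; have [a [ab aP]] := fP _ z01; have [b [bb bP]] := hP _ z01.
exists (fun k => \sum_(i < k.+1) a i * b (k - i)%N); split=> [k|z z1 n].
  apply: le_trans (sum_normc_le _ _) _.
  apply: le_trans (_ : \sum_(i < k.+1) C * C' * N ^+ k <= _).
    apply: ler_sum => i _; rewrite normcM.
    apply: le_trans (ler_pM _ _ (ab i) (bb _)) _; rewrite ?normc_ge0 //.
    by rewrite mulrACA -exprD subnKC // -ltnS.
  rewrite sumr_const card_ord -[leLHS]mulr_natr exprMn -mulrA.
  rewrite ler_wpM2l ?mulr_ge0 // mulrC ler_wpM2r ?exprn_ge0 //.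
pose s := z - z0; rewrite -/s.
pose S m := \sum_(j < m) b j * s ^+ j.
(* Grouping by the index of [a] leaves partial sums of [b] of length n - i, so each term pairs [a i]
   with a remainder of complementary order. *)
have -> : \sum_(k < n) (\sum_(i < k.+1) a i * b (k - i)%N) * s ^+ k =
    \sum_(i < n) a i * s ^+ i * S (n - i)%N.
  elim: n => [|n IHn]; first by rewrite !big_ord0.
  rewrite big_ord_recr IHn /= mulr_suml [RHS]big_ord_recr /=.
  rewrite [X in _ + X]big_ord_recr /= addrA; congr (_ + _).
    rewrite -big_split /=; apply: eq_bigr => i _.
    rewrite subSn ?(ltnW (ltn_ord i)) // /S big_ord_recr /= -/(S _) mulrDr.
    congr (_ + _); rewrite mulrACA -exprD subnKC // ltnW //.
  by rewrite subnn subSn // subnn /S big_ord1 expr0 mulr1; ring.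
have -> : f z * h z - \sum_(i < n) a i * s ^+ i * S (n - i)%N =
    (\sum_(i < n) a i * s ^+ i * (h z - S (n - i)%N)) +
    (f z - \sum_(i < n) a i * s ^+ i) * h z.
  under [X in _ = X + _]eq_bigr do rewrite mulrBr.
  by rewrite sumrB -mulr_suml; ring.
set q := normc s; have q0 : 0 <= q := normc_ge0 _.
apply: le_trans (normcD_le _ _) _.
apply: le_trans (_ : \sum_(i < n) C * C' * (N * q) ^+ n +
                     C * C' * (N * q) ^+ n <= _).
  apply: lerD.
    apply: le_trans (sum_normc_le _ _) _; apply: ler_sum => i _.
    rewrite !normcM normcX -/q.
    have := bP _ z1 (n - i)%N; rewrite -/s -/(S _) -/q => h1.
    have h2 : normc (a i) * q ^+ i <= C * N ^+ i * q ^+ i.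
      by rewrite ler_wpM2r ?exprn_ge0 // ab.
    apply: le_trans (ler_pM _ _ h2 h1) _; rewrite ?normc_ge0 //.
      by rewrite mulr_ge0 ?normc_ge0 ?exprn_ge0.
    rewrite -[C * _ * _]mulrA -exprMn mulrACA -exprD subnKC //.
    exact: ltnW (ltn_ord i).
  rewrite normcM -mulrA [C' * _]mulrC mulrA.
  apply: ler_pM; rewrite ?normc_ge0 ?aP //.
  by have := bP _ z1 0%N; rewrite big_ord0 subr0 expr0 mulr1.
rewrite sumr_const card_ord -mulrSr -[leLHS]mulr_natr.
rewrite -(mulrA 2) [X in _ <= _ * X]exprMn -[leLHS]mulrA ler_wpM2l ?mulr_ge0 //.
by rewrite [leLHS]mulrC ler_wpM2r ?exprn_ge0 ?mulr_ge0.
Qed.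

Lemma circle_analytic_sum (I : Type) (r : seq I) (F : I -> R[i] -> R[i]) :
  (forall i, circle_analytic (F i)) ->
  circle_analytic (fun z => \sum_(i <- r) F i z).
Proof.
move=> FP; elim: r => [|i r IHr].
  apply: circle_analytic_ext (circle_analytic_cst 0) => z _.
  by rewrite big_nil.
apply: circle_analytic_ext (circle_analyticD (FP i) IHr) => z _.
by rewrite big_cons.
Qed.

Lemma circle_analytic_prod (I : Type) (r : seq I) (F : I -> R[i] -> R[i]) :
  (forall i, circle_analytic (F i)) ->
  circle_analytic (fun z => \prod_(i <- r) F i z).
Proof.
move=> FP; elim: r => [|i r IHr].
  apply: circle_analytic_ext (circle_analytic_cst 1) => z _.
  by rewrite big_nil.
apply: circle_analytic_ext (circle_analyticM (FP i) IHr) => z _.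
by rewrite big_cons.
Qed.

Lemma circle_analytic_det m (F : R[i] -> 'M[R[i]]_m) :
  (forall i j, circle_analytic (fun z => F z i j)) ->
  circle_analytic (fun z => \det (F z)).
Proof.
move=> FP; rewrite /determinant.
apply: circle_analytic_sum => s.
apply: circle_analyticM; first exact: circle_analytic_cst.
by apply: circle_analytic_prod => i; exact: FP.
Qed.

(** * Clusters of zeros and the identity principle *)

Definition zeros_cluster f z0 : Prop := forall e, 0 < e ->
  exists z, [/\ normc z = 1, f z = 0 & 0 < normc (z - z0) < e].

Lemma geometric_small (x C e : R) : 0 <= x -> x <= 2^-1 -> 0 <= C -> 0 < e ->
  exists n, C * x ^+ n <= e.
Proof.
move=> x0 x2 C0 e0; exists (Num.truncn (C / e)).
set n := Num.truncn _.
have h1 : C / e <= n.+1%:R by apply: ltW; exact: truncnS_gt.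
have h2 : n.+1%:R <= 2 ^+ n :> R by rewrite -natrX ler_nat ltn_expl.
have h3 : x ^+ n <= (2 ^+ n)^-1.
  by rewrite -exprVn lerXn2r ?nnegrE ?invr_ge0.
apply: le_trans (ler_wpM2l C0 h3) _.
rewrite ler_pdivrMr ?exprn_gt0 // mulrC -ler_pdivrMr //.
exact: le_trans h1 h2.
Qed.

(** All coefficients at [z0] vanish: if those below k do, the expansion of order k + 1 at a zero z
    bounds [a k] by a multiple of |z - z0|, which can be arbitrarily small. What is left of f is the
    remainder, at most C 2^-n for every n. *)
Lemma zeros_cluster_vanish f C M z0 : 0 <= C -> 1 <= M ->
  circle_expansion f C M -> normc z0 = 1 -> zeros_cluster f z0 ->
  forall w, normc w = 1 -> M * normc (w - z0) <= 2^-1 -> f w = 0.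
Proof.
move=> C0 M1 fP z01 acc w w1 wM; have [a [ab aP]] := fP _ z01.
have a0 k : a k = 0.
  elim/ltn_ind: k => k IHk.
  apply/eqP; rewrite -normc_eq0 eq_le normc_ge0 andbT.
  apply/ler_addgt0Pr => e e0; rewrite add0r.
  have D0 : 0 < C * M ^+ k.+1 + 1.
    by rewrite ltr_wpDl // mulr_ge0 // exprn_ge0 // (le_trans ler01).
  have [z [z1 fz /andP[s0 se]]] := acc _ (divr_gt0 e0 D0).
  have := aP z z1 k.+1; rewrite fz big_ord_recr big1 /= => [|i _]; last first.
    by rewrite IHk // mul0r.
  rewrite !add0r normcN_eq normcM normcX.
  set q := normc (z - z0) in s0 se *.
  rewrite exprMn (exprS q) !mulrA ler_pM2r ?exprn_gt0 // => h.
  apply: le_trans h _; move: se; rewrite ltr_pdivlMr // => /ltW h.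
  apply: le_trans h; rewrite mulrC ler_wpM2l ?(ltW s0) //; lra.
apply/eqP; rewrite -normc_eq0 eq_le normc_ge0 andbT.
apply/ler_addgt0Pr => e e0; rewrite add0r.
have x0 : 0 <= M * normc (w - z0).
  by rewrite mulr_ge0 ?normc_ge0 // (le_trans ler01).
have [n hn] := geometric_small x0 wM C0 e0.
have := aP w w1 n; rewrite big1 => [|i _]; last by rewrite a0 mul0r.
by rewrite subr0 => h; exact: le_trans h hn.
Qed.

Lemma unit_near1 e : 0 < e -> exists u, normc u = 1 /\ 0 < normc (u - 1) < e.
Proof.
move=> e0; pose t := Num.min 1 (e / 3).
have t0 : 0 < t by rewrite lt_min ltr01 divr_gt0.
have te : 3 * t <= e.
  have te : t <= e / 3 by rewrite ge_min lexx orbT.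
  lra.
pose d := 1 + t ^+ 2.
have d0 : 0 < d by rewrite /d; have := sqr_ge0 t; lra.
have d1 : 1 <= d by rewrite /d; have := sqr_ge0 t; lra.
(* Rational parametrisation of the circle by the tangent of the half angle. *)
pose u : R[i] := ((1 - t ^+ 2) / d +i* (2 * t / d))%C.
have dn : d != 0 by rewrite gt_eqF.
exists u; split.
  apply/eqP; rewrite -sqrp_eq1 ?normc_ge0 // normc_sqr /= /d.
  by apply/eqP; field; rewrite -/d dn.
have E : normc (u - 1) ^+ 2 = 4 * t ^+ 2 / d.
  by rewrite normc_sqr /= /d; field; rewrite -/d dn.
apply/andP; split.
  rewrite lt_neqAle normc_ge0 andbT eq_sym.
  apply/eqP => h; move: E; rewrite h expr0n /= => /esym/eqP.
  by rewrite gt_eqF // divr_gt0 // mulr_gt0 // exprn_gt0.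
rewrite -ltr_sqr ?nnegrE ?normc_ge0 ?(ltW e0) // E.
rewrite ltr_pdivrMr //.
have : 0 <= e ^+ 2 * (d - 1) by rewrite mulr_ge0 ?sqr_ge0 // subr_ge0.
have : 0 < t ^+ 2 by rewrite exprn_gt0.
nra.
Qed.

(** The strict inequality leaves a whole arc around [w] on which f vanishes, and this arc clusters
    at [w]. *)
Lemma zeros_cluster_step f C M z0 w : 0 <= C -> 1 <= M ->
  circle_expansion f C M -> normc z0 = 1 -> zeros_cluster f z0 ->
  normc w = 1 -> M * normc (w - z0) < 2^-1 -> zeros_cluster f w.
Proof.
move=> C0 M1 fP z01 acc w1 wM e e0.
have M0 : 0 < M by lra.
pose e' := Num.min e ((2^-1 - M * normc (w - z0)) / M).
have e'0 : 0 < e' by rewrite lt_min e0 divr_gt0 // subr_gt0.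
have [u [u1 /andP[u0 ue]]] := unit_near1 e'0.
have d : normc (w * u - w) = normc (u - 1).
  by rewrite -[X in _ - X]mulr1 -mulrBr normcM w1 mul1r.
have wu1 : normc (w * u) = 1 by rewrite normcM w1 u1 mul1r.
move: ue; rewrite lt_min => /andP[ue ue'].
exists (w * u); split; rewrite ?d ?u0 //.
apply: (zeros_cluster_vanish C0 M1 fP z01 acc wu1).
have : normc (w * u - z0) <= normc (u - 1) + normc (w - z0).
  by rewrite -d; have := normcD_le (w * u - w) (w - z0); rewrite addrA subrK.
move=> /(ler_wpM2l (ltW M0)); move: ue'; rewrite ltr_pdivlMr // mulrDr; lra.
Qed.

Lemma sqrtc_Re_ge0 z : 0 <= Re (sqrtc z).
Proof. by case: z => a b; rewrite /sqrtc /= sqrtr_ge0. Qed.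

(** Iterated principal square roots tend to 1: a root y has nonnegative real part, so |y + 1|^2 >=
    2, and y^2 - 1 = (y - 1)(y + 1) shows that |y - 1|^2 is at most half of |y^2 - 1|^2. The powers
    of [y] then lead from 1 to [v] in equal short steps, with no use of arguments or
    exponentials. *)
Lemma unit_root_near1 v e : normc v = 1 -> 0 < e ->
  exists y n, [/\ normc y = 1, y ^+ n = v & normc (y - 1) < e].
Proof.
move=> v1 e0; pose y k := iter k (@sqrtc R) v.
have yS k : y k.+1 ^+ 2 = y k by rewrite /y iterS sqr_sqrtc.
have y1 k : normc (y k) = 1.
  elim: k => // k IHk; apply/eqP.
  by rewrite -sqrp_eq1 ?normc_ge0 // -normcX yS IHk.
have yX k : y k ^+ (2 ^ k) = v.
  by elim: k => [|k IHk]; rewrite ?expr1 // expnS exprM yS.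
have yd k : normc (y k - 1) ^+ 2 <= 4 * 2^-1 ^+ k.
  elim: k => [|k IHk].
    rewrite expr0; have := normcB_le v 1; rewrite v1 normc1.
    have := normc_ge0 (v - 1); rewrite /y /=; nra.
  have E : normc (y k - 1) ^+ 2 =
      normc (y k.+1 - 1) ^+ 2 * normc (y k.+1 + 1) ^+ 2.
    by rewrite -exprMn -normcM -yS; congr (normc _ ^+ _); ring.
  have h : 2 <= normc (y k.+1 + 1) ^+ 2.
    have := sqrtc_Re_ge0 (y k); rewrite -[sqrtc _]/(y k.+1) => re0.
    have : Re (y k.+1) ^+ 2 + Im (y k.+1) ^+ 2 = 1.
      by rewrite -normc_sqr y1 expr1n.
    rewrite normc_sqr; move: re0; case: (y k.+1) => a b /= re0 h1.
    have -> : (a + 1) ^+ 2 + (b + 0) ^+ 2 = (a ^+ 2 + b ^+ 2) + 2 * a + 1 by ring.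
    by rewrite h1; lra.
  move: h (sqr_ge0 (normc (y k.+1 - 1))) IHk; rewrite E (exprS 2^-1).
  set p := normc (y k.+1 - 1) ^+ 2; set q := normc (y k.+1 + 1) ^+ 2.
  move: p q (2^-1 ^+ k) => p q t h p0 IHk.
  have := ler_wpM2l p0 h; lra.
have [n hn] : exists n, 4 * 2^-1 ^+ n <= (e / 2) ^+ 2.
  by apply: geometric_small; rewrite ?exprn_gt0 ?divr_gt0.
exists (y n), (2 ^ n)%N; split => //.
have : normc (y n - 1) <= e / 2.
  by rewrite -ler_sqr ?nnegrE ?normc_ge0 ?divr_ge0 ?(ltW e0) // (le_trans (yd n)).
by move=> h; apply: le_lt_trans h _; rewrite ltr_pdivrMr // mulr_natr mulr2n ltrDl.
Qed.

(** The cluster property passes along the chain z0 y^j from [z0] to [w]. All steps have length |y -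
    1| < 1/(2M), and the single [M] valid at every centre lets each of them be taken. *)
Lemma circle_identity f z0 : circle_analytic f -> normc z0 = 1 ->
  zeros_cluster f z0 -> forall w, normc w = 1 -> f w = 0.
Proof.
move=> [C [M [C0 M1 fP]]] z01 acc w w1.
have M0 : 0 < M by lra.
have z0n : z0 != 0 by rewrite -normc_eq0 z01 oner_eq0.
have v1 : normc (w / z0) = 1 by rewrite normcM normcV z01 w1 invr1 mulr1.
have e0 : 0 < (2 * M)^-1 by rewrite invr_gt0 mulr_gt0.
have [y [n [y1 yn yd]]] := unit_root_near1 v1 e0.
have h j : normc (z0 * y ^+ j) = 1 /\ zeros_cluster f (z0 * y ^+ j).
  elim: j => [|j [IH1 IH2]]; first by rewrite expr0 mulr1.
  have Y1 : normc (z0 * y ^+ j.+1) = 1.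
    by rewrite normcM normcX z01 y1 expr1n mulr1.
  split=> //; apply: (zeros_cluster_step C0 M1 fP IH1 IH2 Y1).
  have -> : z0 * y ^+ j.+1 - z0 * y ^+ j = z0 * y ^+ j * (y - 1).
    by rewrite exprS; ring.
  rewrite normcM IH1 mul1r; move: yd.
  rewrite invfM => yd; have := ltr_pM2l M0 (normc (y - 1)) (2^-1 / M).
  by rewrite yd mulrCA mulfV ?gt_eqF // mulr1.
have [_] := h n; rewrite yn mulrC divfK // => accw.
apply: (zeros_cluster_vanish C0 M1 fP w1 accw w1).
by rewrite subrr normc0 mulr0.
Qed.

End CircleAnalytic.

(** * Singular vectors of normal and compact operators *)

Section SingularSequences.
Variables (R : realType) (V : lmodType R[i]) (g : V -> V -> R[i]).
Hypothesis gP : semi_inner g.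
Local Notation nm := (snm g).
Implicit Types (x y : V) (F : seq V) (e : R).

(** Orthogonals of finite lists serve as the subspaces of finite codimension; statements with an
    arbitrary [F] take the place of weakly null sequences. *)
Definition orth x F := forall y, y \in F -> g x y = 0.

Lemma orth_cat x F G : orth x (F ++ G) <-> orth x F /\ orth x G.
Proof.
split=> [h|[hF hG] y]; last by rewrite mem_cat => /orP[/hF|/hG].
by split=> y yF; apply: h; rewrite mem_cat yF ?orbT.
Qed.

Lemma orth_lin a x y F : orth x F -> orth y F -> orth (a *: x + y) F.
Proof. by move=> hx hy w wF; rewrite (gPl gP) hx // hy // mulr0 addr0. Qed.

Lemma orth_adjoint (T T' : V -> V) x F :
  (forall x y, g (T x) y = g x (T' y)) -> orth x (map T' F) -> orth (T x) F.
Proof. by move=> TT' h y yF; rewrite TT' h // map_f. Qed.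

Lemma normalize x : nm x != 0 -> nm ((nm x)^-1%:C *: x) = 1.
Proof.
move=> x0; rewrite (nmZ gP) normcC ger0_norm ?invr_ge0 ?nm_ge0 //.
by rewrite mulVf.
Qed.

Definition compact_op (K : V -> V) : Prop :=
  forall u : nat -> V, (exists B, forall n, nm (u n) <= B) ->
    exists (f : nat -> nat) y, (forall m n, (m < n)%N -> (f m < f n)%N) /\
      forall e, 0 < e -> exists n0, forall n, (n0 <= n)%N -> nm (K (u (f n)) - y) <= e.

(* Otherwise one recursively finds unit vectors whose images under [K] are
   orthogonal and bounded below. *)
Lemma compact_small (K : V -> V) : nm_complete g -> lin K -> bdd g K ->
  compact_op K ->
  forall e, 0 < e -> exists F, forall x, orth x F -> nm (K x) <= e * nm x.
Proof.
move=> gcomp Kl Kb Kc e e0; have [K' KK'] := adjoint_exists gP gcomp Kl Kb.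
apply: contrapT => /forallNP nF.
have pickP F : exists x, [/\ orth x F, nm x = 1 & e < nm (K x)].
  have [x /not_implyP[xF /negP]] := (existsNP _).2 (nF F); rewrite -ltNge => h.
  have x0 : nm x != 0.
    apply: contraTneq h => x0; have [c _ /(_ x)] := Kb.
    by rewrite x0 !mulr0 -leNgt.
  exists ((nm x)^-1%:C *: x); split; last 1 first.
  - rewrite linZ // (nmZ gP) normcC ger0_norm ?invr_ge0 ?nm_ge0 //.
    by rewrite mulrC ltr_pdivlMr // lt_neqAle eq_sym x0 nm_ge0.
  - by rewrite -[_ *: x]addr0; apply: orth_lin => // y _; rewrite (g0l gP).
  - exact: normalize.
have [pick {}pickP] := choice pickP.
(* Orthogonality to K'K w gives g (K x) (K w) = 0 for each earlier w. *)
pose next s := pick (map (fun w => K' (K w)) s).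
pose s n := iter n (fun t => next t :: t) [::].
pose u n := next (s n).
have us m n : (m < n)%N -> u m \in s n.
  elim: n => // n IHn; rewrite ltnS leq_eqVlt => /orP[/eqP->|/IHn h].
    by rewrite /s iterS in_cons eqxx.
  by rewrite /s iterS in_cons -/(s n) h orbT.
have [] := Kc u; first by exists 1 => n; have [_ ->] := pickP (map (fun w => K' (K w)) (s n)).
move=> f [y [fmono fP]].
have e20 : 0 < e / 2 by rewrite divr_gt0.
have [n0 n0P] := fP _ e20.
have h1 := n0P n0 (leqnn _); have h2 := n0P n0.+1 (leqnSn _).
have lt_f : (f n0 < f n0.+1)%N by apply: fmono.
have [h3 _ h4] := pickP (map (fun w => K' (K w)) (s (f n0.+1))).
have [_ _ h5] := pickP (map (fun w => K' (K w)) (s (f n0))).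
have h6 : g (K (u (f n0.+1))) (K (u (f n0))) = 0.
  by rewrite KK' h3 // (map_f (fun w => K' (K w))) // us.
have h7 := nm_sqrB gP (K (u (f n0.+1))) (K (u (f n0))).
(* Both images lie within e/2 of [y], yet orthogonal vectors longer than e are more than e apart. *)
have h8 : nm (K (u (f n0.+1)) - K (u (f n0))) <= e.
  rewrite -(subrK y (K (u (f n0.+1)))) -addrA.
  apply: le_trans (nmD_le gP _ _) _; rewrite (nm_distC gP y); lra.
move: h7 h8 h4 h5; rewrite h6 mulr0 subr0 -/(next _) -/(next _) -/(u _) -/(u _).
have := nm_ge0 g (K (u (f n0.+1)) - K (u (f n0))).
move: (nm _) (nm (K (u (f n0.+1)))) (nm (K (u (f n0)))) => p q r; nra.
Qed.

Lemma symmetric_form_step (D : V -> V) (s : R) x : lin D ->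
  (forall x y, g (D x) y = g x (D y)) ->
  let y := (- s)%:C *: D x + x in
  Re (g (D y) y) = Re (g (D x) x) - 2 * s * nm (D x) ^+ 2 +
    s ^+ 2 * Re (g (D (D x)) (D x)).
Proof.
move=> Dl DD y; rewrite /y Dl (gDl gP) !(gDr gP) !(gZl gP) !(gZr gP).
by rewrite conj_realC !ReD !ReCM (DD (D x) x) -(nm_sqr gP); ring.
Qed.

(* [q] is an essential supremum of the quadratic form of [Q]; testing it at
   [x - s (q - Q) x] shows that nearly maximising [x] are nearly eigenvectors. *)
Lemma essential_sup (M Q : V -> V) c0 : lin M -> lin Q -> bdd g Q ->
  (forall x y, g (Q x) y = g x (Q y)) ->
  (forall x, nm (M (Q x) - Q (M x)) = 0) ->
  let level (c : R) := forall F e, 0 < e ->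
    exists x, [/\ orth x F, nm x = 1, nm (M x) <= e & c <= Re (g (Q x) x)] in
  level c0 ->
  exists q : R, (forall c, level c -> c <= q) /\
    forall F e, 0 < e -> exists x,
      [/\ orth x F, nm x = 1, nm (M x) <= e & nm (Q x - q%:C *: x) <= e].
Proof.
move=> Ml Ql [k k0 Qb] QQ MQ level lc0.
have Qub x : nm x = 1 -> Re (g (Q x) x) <= k.
  move=> x1; apply: le_trans (Re_le_normc _) _.
  apply: le_trans (cauchy_schwarz gP _ _) _.
  by have := Qb x; rewrite x1 !mulr1.
have Lub : ubound [set c | level c] k.
  by move=> c /(_ [::] 1 ltr01) [x [_ x1 _ h]]; apply: le_trans h (Qub _ x1).
have Lsup : has_sup [set c | level c] by split; [exists c0|exists k].
pose q := sup [set c | level c].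
have qub c : level c -> c <= q by move=> h; apply: ub_le_sup => //; exists k.
exists q; split=> // F e e0.
pose d := `|q| + 1 + k.
have d1 : 1 <= d by rewrite /d; have := normr_ge0 q; lra.
have d0 : 0 < d by lra.
(* The last bound turns the estimate [D2], |D x|^2 <= 4 d t, into |D x| <= e/2. *)
pose t := Num.min 1 (Num.min (e / 2) (e ^+ 2 / (16 * d))).
have t0 : 0 < t.
  by rewrite !lt_min ltr01 !divr_gt0 ?exprn_gt0 // mulr_gt0.
have t1 : t <= 1 by rewrite /t ge_min lexx.
have t2 : t <= e / 2 by rewrite /t !ge_min lexx orbT.
have t3 : 16 * d * t <= e ^+ 2.
  have : t <= e ^+ 2 / (16 * d) by rewrite /t !ge_min lexx !orbT.
  by rewrite ler_pdivlMr ?mulr_gt0 // mulrC.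
(* As [q + t] is not a level, the form of [D] below is nonnegative on vectors orthogonal to some
   [F0] that [M] nearly kills. *)
have [F0 [e1 [e10 F0P]]] : exists F0 e1, 0 < e1 /\
    forall x, orth x F0 -> nm (M x) <= e1 * nm x ->
      Re (g (Q x) x) <= (q + t) * nm x ^+ 2.
  have : ~ level (q + t) by move/qub; lra.
  move=> /existsNP[F0 /existsNP[e1 /not_implyP[e10 /forallNP h]]].
  exists F0, e1; split=> // x xF0 Mx.
  have [x0|x0] := eqVneq (nm x) 0.
    by rewrite (gC gP) (g_null gP _ x0) conjC0 x0 expr0n mulr0.
  have xp : 0 < nm x by rewrite lt_neqAle eq_sym x0 nm_ge0.
  apply: contrapT => /negP; rewrite -ltNge => h1.
  apply: (h ((nm x)^-1%:C *: x)); split.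
  - by rewrite -[_ *: x]addr0; apply: orth_lin => // y _; rewrite (g0l gP).
  - exact: normalize.
  - rewrite linZ // (nmZ gP) normcC ger0_norm ?invr_ge0 ?nm_ge0 //.
    by rewrite mulrC ler_pdivrMr.
  - rewrite linZ // (gZl gP) (gZr gP) conj_realC !ReCM mulrA -expr2 exprVn.
    by rewrite mulrC ler_pdivlMr ?exprn_gt0 // ltW.
pose D x := (q + t)%:C *: x - Q x.
have Dl : lin D.
  move=> a x y; rewrite /D Ql scalerDr scalerBr !scalerA (mulrC a).
  by rewrite opprD addrACA.
have Db x : nm (D x) <= d * nm x.
  apply: le_trans (nmB_le gP _ _) _; rewrite (nmZ gP) normcC.
  have := Qb x; have := ler_normD q t; have := nm_ge0 g x.
  rewrite (ger0_norm (ltW t0)) /d; nra.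
have DD x y : g (D x) y = g x (D y).
  by rewrite (gBl gP) (gBr gP) (gZl gP) (gZr gP) conj_realC QQ.
have MD x : nm (M (D x)) = nm (D (M x)).
  apply: (nm_eq_of_null gP); rewrite /D linB // linZ // opprB addrC.
  by rewrite addrA subrK (nm_distC gP) MQ.
(* This s keeps [y = x - s D x] at norm at least 1/2, and the quadratic term of
   [symmetric_form_step] takes back at most a quarter of the linear one. *)
pose s := (2 * d)^-1.
have s0 : 0 < s by rewrite invr_gt0 mulr_gt0.
have sd : s * d = 2^-1 by rewrite /s; field; rewrite gt_eqF.
(* [M y] is at most 3/2 times the bound on [M x], while [nm y >= 1/2]; a quarter of [e1] is
   therefore enough for [F0P] to apply to [y]. *)
pose eta := Num.min e (e1 / 4).
have eta0 : 0 < eta by rewrite lt_min e0 divr_gt0.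
have lq : level (q - t).
  have [c lc /ltW hc] := sup_adherent t0 Lsup.
  move=> G a /(lc G)[x [h1 h2 h3 h4]].
  by exists x; split=> //; apply: le_trans hc h4.
(* Since [D] is symmetric, orthogonality to [map D F0] makes [D x], hence also [y], orthogonal to
   [F0]. *)
have [x [xF x1 Mx Qx]] := lq (F ++ (F0 ++ map D F0)) eta eta0.
move: xF => /orth_cat[xF /orth_cat[xF0 xDF0]].
move: Mx; rewrite le_min => /andP[Mx1 Mx2].
exists x; split=> //.
pose y := (- s)%:C *: D x + x.
have yF0 : orth y F0 by apply: orth_lin => //; apply: orth_adjoint xDF0.
have nDx : nm (D x) <= d by have := Db x; rewrite x1 mulr1.
have ns : normc (- s)%:C = s by rewrite normcC normrN gtr0_norm.
have y2 : 2^-1 <= nm y.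
  have : nm x <= nm y + s * nm (D x).
    rewrite -[s]ns -(nmZ gP); apply: le_trans (nmB_le gP _ _).
    by rewrite /y [_ *: _ + x]addrC addrK.
  rewrite x1; have := ler_wpM2l (ltW s0) nDx; lra.
have My : nm (M y) <= e1 * nm y.
  have : nm (M y) <= s * (d * nm (M x)) + nm (M x).
    rewrite /y Ml; apply: le_trans (nmD_le gP _ _) _.
    by rewrite (nmZ gP) ns MD lerD2r ler_wpM2l ?(ltW s0).
  rewrite mulrA sd; have := ler_wpM2l (ltW e10) y2; lra.
have pos : 0 <= Re (g (D y) y).
  rewrite (gBl gP) (gZl gP) ReB ReCM -(nm_sqr gP) subr_ge0.
  exact: F0P.
have Dy : Re (g (D y) y) = Re (g (D x) x) - 2 * s * nm (D x) ^+ 2 +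
    s ^+ 2 * Re (g (D (D x)) (D x)).
  exact: symmetric_form_step.
have DDx : Re (g (D (D x)) (D x)) <= d * nm (D x) ^+ 2.
  apply: le_trans (Re_le_normc _) _; apply: le_trans (cauchy_schwarz gP _ _) _.
  by rewrite expr2 mulrA ler_wpM2r ?nm_ge0.
have Dxx : Re (g (D x) x) <= 2 * t.
  rewrite (gBl gP) (gZl gP) ReB ReCM -(nm_sqr gP) x1 expr1n mulr1; lra.
have D2 : nm (D x) ^+ 2 <= 4 * d * t.
  have h := ler_wpM2l (sqr_ge0 s) DDx.
  have h2 : s ^+ 2 * (d * nm (D x) ^+ 2) = 2^-1 * s * nm (D x) ^+ 2.
    by rewrite mulrA expr2 -(mulrA s) sd; ring.
  have h3 : s * nm (D x) ^+ 2 <= 2 * t.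
    move: pos; rewrite Dy; have := mulr_ge0 (ltW s0) (sqr_ge0 (nm (D x))); lra.
  have := ler_wpM2l (ltW d0) h3; rewrite mulrA (mulrC d s) sd; lra.
have D1 : nm (D x) <= e / 2.
  rewrite -ler_sqr ?nnegrE ?nm_ge0 ?divr_ge0 ?(ltW e0) //; lra.
have -> : Q x - q%:C *: x = t%:C *: x - D x.
  rewrite /D rmorphD /= scalerDl opprB [RHS]addrC.
  by rewrite opprD addrA subrK.
apply: le_trans (nmB_le gP _ _) _.
rewrite (nmZ gP) normcC gtr0_norm // x1; lra.
Qed.

(** If the claim fails, the essential supremum q of the form of N'N is at least 1. Among
    near-eigenvectors of N'N for q, let b be the essential supremum of the form of (N + N')/2. There
    N'N is nearly q and N + N' nearly 2b, so N nearly satisfies a real quadratic equation, against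
    the lower bounds for N at its two roots. *)
Lemma essential_contraction (N N' : V -> V) : lin N -> lin N' -> bdd g N ->
  bdd g N' -> (forall x y, g (N x) y = g x (N' y)) ->
  (forall x, nm (N' (N x) - N (N' x)) = 0) ->
  (forall l : R[i], 1 <= normc l -> exists F e, 0 < e /\
     forall x, orth x F -> nm x = 1 -> e < nm (N x - l *: x)) ->
  exists F (r : R), [/\ 0 <= r, r < 1 & forall x, orth x F -> nm (N x) <= r * nm x].
Proof.
move=> Nl N'l [k k0 Nb] [k' k'0 N'b] NN' Nn reg.
have N'N x y : g (N' x) y = g x (N y) by rewrite (gC gP) -NN' -(gC gP).
apply: contrapT => noF.
pose P x := N' (N x).
have Pl : lin P by move=> a x y; rewrite /P Nl N'l.
have Pb : bdd g P.
  exists (k' * k); first exact: mulr_ge0.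
  move=> x; apply: le_trans (N'b _) _; rewrite -mulrA.
  exact: ler_wpM2l (Nb x).
have PP x y : g (P x) y = g x (P y) by rewrite /P N'N NN'.
have Pxx x : Re (g (P x) x) = nm (N x) ^+ 2 by rewrite N'N (nm_sqr gP).
have lvl (c : R) : 0 <= c -> c < 1 -> forall F e, 0 < e -> exists x,
    [/\ orth x F, nm x = 1, nm (0 : V) <= e & c ^+ 2 <= Re (g (P x) x)].
  move=> c0 c1 F e e0.
  have : ~ forall x, orth x F -> nm (N x) <= c * nm x.
    by move=> h; apply: noF; exists F, c.
  move=> /existsNP[x /not_implyP[xF /negP]]; rewrite -ltNge => h.
  have x0 : nm x != 0.
    apply: contraTneq h => x0; have := Nb x.
    by rewrite x0 !mulr0 -leNgt.
  have xp : 0 < nm x by rewrite lt_neqAle eq_sym x0 nm_ge0.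
  exists ((nm x)^-1%:C *: x); split.
  - by rewrite -[_ *: x]addr0; apply: orth_lin => // y _; rewrite (g0l gP).
  - exact: normalize.
  - by rewrite (nm0 gP) ltW.
  - rewrite Pxx lerXn2r ?nnegrE ?nm_ge0 // linZ // (nmZ gP) normcC.
    rewrite ger0_norm ?invr_ge0 ?nm_ge0 // mulrC ler_pdivlMr //.
    exact: ltW.
have zl : lin (fun=> 0 : V) by move=> a x y; rewrite scaler0 addr0.
have z1 (x : V) : nm ((0 : V) - P 0) = 0 by rewrite (lin0 Pl) subr0 (nm0 gP).
(* First use, with the constraint operator 0. *)
have [q [qub qP]] := essential_sup zl Pl Pb PP z1 (lvl 0 (lexx _) ltr01).
clear z1.
have q1 : 1 <= q.
  apply/ler_addgt0Pl => e e0; rewrite -lerBlDl.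
  have [e1|e1] := leP 1 e; first by have := qub _ (lvl 0 (lexx _) ltr01); rewrite expr0n /=; lra.
  have h1 : 0 <= 1 - e / 2 by lra.
  have h2 : 1 - e / 2 < 1 by lra.
  have := qub _ (lvl _ h1 h2); have := sqr_ge0 (e / 2); rewrite sqrrB; lra.
(* Second use, constrained to near-eigenvectors of [P]; normality makes [M] and [Q] commute up to
   null vectors. *)
pose M x := P x - q%:C *: x.
have Ml : lin M by exact: lin_shift.
pose Q x := (2^-1 : R)%:C *: (N x + N' x).
have Ql : lin Q.
  move=> a x y; rewrite /Q Nl N'l addrACA -scalerDr [LHS]scalerDr !scalerA.
  by rewrite mulrC.
have Qb : bdd g Q.
  exists (k + k'); first exact: addr_ge0.
  move=> x; rewrite /Q (nmZ gP) normcC ger0_norm //.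
  have := nmD_le gP (N x) (N' x); have := Nb x; have := N'b x.
  have := nm_ge0 g (N x + N' x); lra.
have QQ x y : g (Q x) y = g x (Q y).
  by rewrite /Q (gZl gP) (gZr gP) conj_realC (gDl gP) (gDr gP) NN' N'N addrC.
have nullP x : nm x = 0 <-> forall y, g x y = 0.
  by split=> [x0 y|h]; [exact: (g_null gP)|exact: nm_null].
have nn x y : g (N' (N x)) y = g (N (N' x)) y.
  by apply/eqP; rewrite -subr_eq0 -(gBl gP) (proj1 (nullP _) (Nn x)).
have NQ x y : g (N (Q x)) y = g (Q (N x)) y.
  by rewrite /Q linZ // linD // !(gZl gP) !(gDl gP) nn.
have N'Q x y : g (N' (Q x)) y = g (Q (N' x)) y.
  by rewrite /Q (linZ N'l) (linD N'l) !(gZl gP) !(gDl gP) nn.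
have MQ x : nm (M (Q x) - Q (M x)) = 0.
  apply/nullP => y; rewrite /M (linB Ql) (linZ Ql) opprB addrA subrK.
  rewrite (gBl gP) /P N'N NQ -N'N.
  by rewrite N'Q subrr.
have lvl2 : forall F e, 0 < e -> exists x,
    [/\ orth x F, nm x = 1, nm (M x) <= e & - (k + k') <= Re (g (Q x) x)].
  move=> F e e0; have [x [h1 h2 _ h3]] := qP F e e0; exists x; split=> //.
  rewrite lerNl; apply: le_trans (_ : normc (g (Q x) x) <= _).
    by have := normc_Re_ge (g (Q x) x); lra.
  apply: le_trans (cauchy_schwarz gP _ _) _.
  have [k2 _ Qb'] := Qb; rewrite h2 mulr1.
  rewrite /Q (nmZ gP) normcC ger0_norm //.
  have := nmD_le gP (N x) (N' x); have := Nb x; have := N'b x.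
  have := nm_ge0 g (N x + N' x); rewrite h2; lra.
have [b [_ bP]] := essential_sup Ml Ql Qb QQ MQ lvl2.
(* On the vectors found, b is close to Re g (N x) x, which is at most |N x|, and |N x|^2 is close to
   q. Hence the roots are conjugate, of modulus sqrt q. *)
have b2 : b ^+ 2 <= q.
  have q0 : 0 <= q by lra.
  have [r r0 rq] : exists2 r : R, 0 <= r & r ^+ 2 = q.
    by exists (Num.sqrt q); rewrite ?sqrtr_ge0 ?sqr_sqrtr.
  have : `|b| <= r.
    apply/ler_addgt0Pl => e e0.
    pose t := Num.min (e / 2) ((e / 2) ^+ 2).
    have t0 : 0 < t by rewrite lt_min exprn_gt0 divr_gt0.
    have t1 : t <= e / 2 by rewrite ge_min lexx.
    have t2 : t <= (e / 2) ^+ 2 by rewrite ge_min lexx orbT.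
    have [x [_ x1 Mx Qx]] := bP [::] t t0.
    have h1 : nm (N x) ^+ 2 <= q + t.
      rewrite -Pxx; have -> : P x = M x + q%:C *: x by rewrite subrK.
      rewrite (gDl gP) (gZl gP) ReD ReCM -(nm_sqr gP) x1 expr1n mulr1 addrC lerD2l.
      apply: le_trans (Re_le_normc _) _; apply: le_trans (cauchy_schwarz gP _ _) _.
      by rewrite x1 mulr1.
    have h2 : nm (N x) <= r + e / 2.
      rewrite -ler_sqr ?nnegrE ?nm_ge0 //; last lra.
      by rewrite sqrrD rq; have := mulr_ge0 r0 (ltW e0); lra.
    have h3 : normc (b%:C) <= nm (N x) + t.
      have E : b%:C = (Re (g (N x) x))%:C - g (Q x - b%:C *: x) x.
        rewrite (gBl gP) (gZl gP) (gxxE gP) x1 expr1n mulr1 opprB.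
        rewrite /Q (gZl gP) (gDl gP) N'N (gC gP (N x) x).
        apply: complex_ext; rewrite ?ReD ?ReN.
          by rewrite ReCM ReD ReJ /=; field.
        by case: (g (N x) x) => u v /=; ring.
      rewrite E; apply: le_trans (normcB_le _ _) _; apply: lerD.
        rewrite normcC ler_norml.
        have := cauchy_schwarz gP (N x) x; rewrite x1 mulr1.
        have := Re_le_normc (g (N x) x); have := normc_Re_ge (g (N x) x).
        by move=> *; apply/andP; split; lra.
      by apply: le_trans (cauchy_schwarz gP _ _) _; rewrite x1 mulr1.
    by move: h3; rewrite normcC; lra.
  by move=> h; rewrite -real_normK ?num_real // -rq lerXn2r ?nnegrE.
(* [N^2 - 2 b N + q = (N - l) (N - conj l)] with [|l|^2 = q >= 1]. *)
pose l : R[i] := (b +i* Num.sqrt (q - b ^+ 2))%C.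
have l1 : 1 <= normc l.
  rewrite -(@ler_sqr _ 1) ?nnegrE ?normc_ge0 // normc_sqr /= sqr_sqrtr ?subr_ge0 //.
  by rewrite expr1n addrC subrK.
have l1' : 1 <= normc l^* by rewrite normc_conj.
have [F1 [e1 [e10 F1P]]] := reg _ l1.
have [F2 [e2 [e20 F2P]]] := reg _ l1'.
pose L x := N x - l^* *: x; pose L' x := N' x - l *: x.
have LL' x y : g (L x) y = g x (L' y).
  by rewrite (gBl gP) (gBr gP) (gZl gP) (gZr gP) NN'.
(* The two lower bounds give more than e1 e2 for (N - l)(N - conj l) x, the near-equation at most (2
   k + 1) e < e1 e2. *)
pose e := e1 * e2 / (2 * k + 2).
have e0 : 0 < e by rewrite divr_gt0 ?mulr_gt0 //; lra.
have [x [xF x1 Mx Qx]] := bP (F2 ++ map L' F1) e e0.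
move: xF => /orth_cat[xF2 xF1].
have LF1 : orth (L x) F1 by apply: orth_adjoint xF1.
have Lx := F2P x xF2 x1.
have Lxp : 0 < nm (L x) by apply: lt_trans e20 _.
have Lx0 : nm (L x) != 0 by rewrite gt_eqF.
pose y := (nm (L x))^-1%:C *: L x.
have y1 : nm y = 1 by exact: normalize.
have yF1 : orth y F1.
  by rewrite /y -[_ *: _]addr0; apply: orth_lin => // w _; rewrite (g0l gP).
have := F1P y yF1 y1.
have -> : N y - l *: y = (nm (L x))^-1%:C *: (N (L x) - l *: L x).
  rewrite /y (linZ Nl) [RHS]scalerBr !scalerA.
  by rewrite (mulrC l).
rewrite (nmZ gP) normcC ger0_norm ?invr_ge0 ?nm_ge0 // mulrC ltr_pdivlMr //.
suff small : nm (N (L x) - l *: L x) <= (2 * k + 1) * e.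
  move=> h; have h1 : e1 * nm (L x) < (2 * k + 1) * e by apply: lt_le_trans h small.
  have h2 : (2 * k + 2) * e = e1 * e2.
    by rewrite /e mulrC divfK // gt_eqF //; lra.
  have := ltr_pM2l e10 e2 (nm (L x)); rewrite Lx; lra.
(* Up to null vectors 2 N Q = N^2 + P by normality, so (N - l)(N - conj l) = 2 N (Q - b) - (P -
   q). *)
have -> : nm (N (L x) - l *: L x) =
    nm (2%:C *: N (Q x - b%:C *: x) - M x).
  apply: (nm_eq_of_null gP); apply/nullP => w.
  rewrite /L /M /P (linB Nl (N x)) (linB Nl (Q x)).
  rewrite (linZ Nl l^* x) (linZ Nl b%:C x).
  rewrite !(gBl gP) (gZl gP 2%:C) !(gBl gP) NQ /Q !(gZl gP) (gDl gP).
  have s1 : l + l^* = 2%:C * b%:C.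
    by apply: complex_ext => /=; rewrite ?ReD /=; ring.
  have s2 : l * l^* = q%:C.
    rewrite mulc_conj normc_sqr /= sqr_sqrtr ?subr_ge0 //.
    by rewrite addrC subrK.
  have s3 : 2%:C * (2^-1 : R)%:C = 1 :> R[i].
    by rewrite -rmorphM /= mulfV ?pnatr_eq0.
  rewrite -s2 mulrBr !mulrA s3 -s1 (gNl gP) (gZl gP) (gDl gP).
  by ring.
apply: le_trans (nmB_le gP _ _) _.
rewrite (nmZ gP) normcC ger0_norm //.
have := Nb (Q x - b%:C *: x); have := ler_wpM2l k0 Qx; lra.
Qed.

(** Up to null vectors x = S (T - l) x - K2 x. Off finitely many directions [K] and [K2] are small:
    if |N x - l x| were at most 1/(4 (s + 1)), the right side would have norm at most 1/2 + 1/4. *)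
Lemma fredholm_bounded_below (N K S K2 T : V -> V) (l : R[i]) :
  nm_complete g -> lin K -> bdd g K -> compact_op K ->
  lin K2 -> bdd g K2 -> compact_op K2 -> bdd g S ->
  (forall x, T x = N x + K x) ->
  (forall x, nm (S (T x - l *: x) - x - K2 x) = 0) ->
  exists F e, 0 < e /\
    forall x, orth x F -> nm x = 1 -> e < nm (N x - l *: x).
Proof.
move=> gcomp Kl Kb Kc K2l K2b K2c [s s0 Sb] TNK ST.
have q0 : 0 < (4 * (s + 1))^-1 by rewrite invr_gt0; lra.
have [F1 F1P] := compact_small gcomp Kl Kb Kc q0.
have [F2 F2P] := compact_small gcomp K2l K2b K2c (ltac:(by []) : 0 < 4^-1 :> R).
exists (F1 ++ F2), (4 * (s + 1))^-1; split=> // x /orth_cat[xF1 xF2] x1.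
have h1 := F1P x xF1; have h2 := F2P x xF2.
have E : nm (S (T x - l *: x) - K2 x) = nm x.
  by apply: (nm_eq_of_null gP); rewrite addrAC ST.
have h3 := nmB_le gP (S (T x - l *: x)) (K2 x).
have h4 := Sb (T x - l *: x).
have h5 : nm (T x - l *: x) <= nm (N x - l *: x) + nm (K x).
  by rewrite TNK addrAC; exact: nmD_le.
rewrite ltNge; apply/negP => h6.
move: E h1 h2 h3 h4; rewrite x1 !mulr1 => -> h1 h2 h3 h4.
have h7 := ler_wpM2l s0 h5.
have h8 : s * (nm (N x - l *: x) + nm (K x)) <= s * (2 * (4 * (s + 1))^-1).
  by apply: ler_wpM2l => //; lra.
have h9 : s * (2 * (4 * (s + 1))^-1) <= 2^-1.
  have -> : s * (2 * (4 * (s + 1))^-1) = s / (2 * (s + 1)).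
    by field; rewrite gt_eqF //; lra.
  rewrite ler_pdivrMr; lra.
lra.
Qed.

End SingularSequences.

(** * Contact of the numerical range with the circle *)

Section NumericalRange.
Variables (R : realType) (V : lmodType R[i]) (g : V -> V -> R[i]).
Hypotheses (gP : semi_inner g) (gcomp : nm_complete g).
Local Notation nm := (snm g).
Implicit Types (x y : V) (z : R[i]) (F E : seq V).

Definition orthonormal_seq E := forall i j, (i < size E)%N -> (j < size E)%N ->
  g E`_i E`_j = (i == j)%:R.

Definition proj E x := \sum_(i < size E) g x E`_i *: E`_i.

Lemma g_projl E x y : g (proj E x) y = \sum_(i < size E) g x E`_i * g E`_i y.
Proof. by rewrite /proj (g_suml gP); apply: eq_bigr => i _; rewrite (gZl gP). Qed.

Lemma projC E x y : g (proj E x) y = g x (proj E y).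
Proof.
rewrite [RHS](gC gP) !g_projl raddf_sum /=; apply: eq_bigr => i _.
by rewrite conjcM -!(gC gP) mulrC.
Qed.

Lemma proj_lin E : lin (proj E).
Proof.
move=> a x y; rewrite /proj scaler_sumr -big_split /=.
by apply: eq_bigr => i _; rewrite (gPl gP) scalerDl scalerA.
Qed.

Lemma g_proj_nth E x k : orthonormal_seq E -> (k < size E)%N ->
  g (proj E x) E`_k = g x E`_k.
Proof.
move=> EO kE; rewrite g_projl (bigD1 (Ordinal kE)) //= EO // eqxx mulr1.
rewrite big1 ?addr0 // => i ik; rewrite EO //.
case: eqP => [ik'|]; last by rewrite mulr0.
by move: ik; rewrite -val_eqE /= ik' eqxx.
Qed.

Lemma orth_proj E x : orthonormal_seq E -> orth g (x - proj E x) E.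
Proof.
move=> EO y /(nthP 0)[k kE <-].
by rewrite (gBl gP) g_proj_nth // subrr.
Qed.

Lemma orth_projr E x y : orth g x E -> g x (proj E y) = 0.
Proof.
move=> xE; rewrite -projC g_projl big1 // => i _.
by rewrite xE ?mul0r // mem_nth.
Qed.

(** Gram-Schmidt, dropping a vector whose residue is null: such a residue is orthogonal to
    everything. *)
Lemma orthonormal_exists F :
  exists E, orthonormal_seq E /\ forall x, orth g x E -> orth g x F.
Proof.
elim: F => [|w F [E [EO EF]]]; first by exists [::].
pose w0 := w - proj E w; have w0E : orth g w0 E := orth_proj w EO.
have [w00|w00] := eqVneq (nm w0) 0.
  exists E; split=> // x xE y; rewrite in_cons => /orP[/eqP->|]; last exact: EF.
  rewrite -(subrK (proj E w) w) (gDr gP) orth_projr // addr0.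
  by rewrite (gC gP) (g_null gP) // conjC0.
pose v := (nm w0)^-1%:C *: w0.
have vE : orth g v E.
  by rewrite /v -[_ *: _]addr0; apply: (orth_lin gP) => // y _; rewrite (g0l gP).
have gvv : g v v = 1 by rewrite (gxxE gP) normalize // expr1n.
exists (v :: E); split.
  move=> [|i] [|j] //= iE jE.
  - by rewrite vE // mem_nth.
  - by rewrite (gC gP) vE ?conjC0 // mem_nth.
  - by rewrite EO.
move=> x xvE; have xE : orth g x E by move=> y yE; apply: xvE; rewrite in_cons yE orbT.
move=> y; rewrite in_cons => /orP[/eqP->|]; last exact: EF.
rewrite -(subrK (proj E w) w) (gDr gP) orth_projr // addr0.
have -> : w - proj E w = (nm w0)%:C *: v.
  by rewrite /v scalerA -rmorphM /= mulfV // scale1r.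
by rewrite (gZr gP) xvE ?mulr0 // mem_head.
Qed.

Lemma g_proj_self E x : orthonormal_seq E ->
  g (proj E x) x = g (proj E x) (proj E x).
Proof.
move=> EO; apply/eqP; rewrite -subr_eq0 -(gBr gP).
by rewrite (gC gP) (orth_projr _ (orth_proj x EO)) conjC0.
Qed.

Lemma nm_proj E x : orthonormal_seq E -> nm (proj E x) <= nm x.
Proof.
move=> EO; have h : nm (proj E x) ^+ 2 <= nm x * nm (proj E x).
  rewrite (nm_sqr gP) -g_proj_self // (gC gP) ReJ.
  apply: le_trans (Re_le_normc _) _; exact: cauchy_schwarz.
have [->|p0] := eqVneq (nm (proj E x)) 0; first exact: nm_ge0.
by move: h; rewrite expr2 ler_pM2r // lt_neqAle eq_sym p0 nm_ge0.
Qed.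

Variable T : V -> V.
Hypotheses (Tlin : lin T) (Tbdd : bdd g T).
Hypothesis numradius : forall x, normc (g (T x) x) <= nm x ^+ 2.

(* [Re (1 - z^-1 T)] as a form; for [|z| = 1] it vanishes at a unit vector [x]
   exactly when [g (T x) x = z]. *)
Definition contact_form z x y : R[i] :=
  g x y - (2^-1 : R)%:C * (z^* * g (T x) y + z * g x (T y)).

Lemma contact_form_diag z x :
  Re (contact_form z x x) = nm x ^+ 2 - Re (z^* * g (T x) x).
Proof.
rewrite /contact_form ReB ReCM -(nm_sqr gP) ReD.
have -> : z * g x (T x) = (z^* * g (T x) x)^* by rewrite conjcM conjCK -(gC gP).
by rewrite ReJ; congr (_ - _); field.
Qed.

Lemma contact_form_semi_inner z : normc z = 1 -> semi_inner (contact_form z).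
Proof.
move=> z1; split=> [a x y w|x y|x].
- by rewrite /contact_form Tlin !(gPl gP); ring.
- rewrite /contact_form conjcB !conjcM conjcD !conjcM conj_realC conjCK.
  by rewrite -!(gC gP); ring.
rewrite lecE; apply/andP; split.
  have : contact_form z x x = (contact_form z x x)^*.
    rewrite /contact_form conjcB !conjcM conjcD !conjcM conj_realC conjCK.
    by rewrite -!(gC gP); ring.
  by case: (contact_form z x x) => a b /= [] /eqP; rewrite -addr_eq0 -mulr2n mulrn_eq0.
rewrite contact_form_diag /= subr_ge0.
apply: le_trans (Re_le_normc _) _.
by rewrite normcM normc_conj z1 mul1r numradius.
Qed.

Lemma contact_form_le z x : normc z = 1 -> snm (contact_form z) x <= 2 * nm x.
Proof.
move=> z1; have hP := contact_form_semi_inner z1.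
rewrite -ler_sqr ?nnegrE ?mulr_ge0 ?nm_ge0 // (nm_sqr hP) contact_form_diag.
have := normc_Re_ge (z^* * g (T x) x).
rewrite normcM normc_conj z1 mul1r; have := numradius x; rewrite exprMn.
have := sqr_ge0 (nm x); lra.
Qed.

Variables (E : seq V) (r : R).
Hypotheses (EO : orthonormal_seq E) (r1 : r < 1).
Hypothesis Er : forall x, orth g x E -> normc (g (T x) x) <= r * nm x ^+ 2.

Local Notation m := (size E).
Local Notation P := (proj E).

Definition coercive_form z x y : R[i] := contact_form z x y + g (P x) y.

(** Write x = q + p with p = P x, and h for the contact form. Then h(q) <= 2 h(x) + 2 h(p) and h(p)
    <= 2 |p|^2 give (1 - r) |q|^2 <= 2 h(x) + 4 |p|^2, so |x|^2 <= (1 + 4/(1 - r)) (h(x) +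
    |p|^2). *)
Definition coercivity : R := (1 + 4 / (1 - r))^-1.
Local Notation dl := coercivity.

Lemma coercivity_gt0 : 0 < dl.
Proof. by rewrite invr_gt0 addr_gt0 // divr_gt0 // subr_gt0. Qed.

Lemma coercivity_le1 : dl <= 1.
Proof.
by rewrite invf_le1 ?addr_gt0 ?divr_gt0 ?subr_gt0 // lerDl divr_ge0 // subr_ge0 ltW.
Qed.

Lemma coercive_form_semi_inner z : normc z = 1 -> semi_inner (coercive_form z).
Proof.
move=> z1; have hP := contact_form_semi_inner z1.
split=> [a x y w|x y|x]; rewrite /coercive_form.
- by rewrite (gPl hP) proj_lin (gPl gP); ring.
- by rewrite conjcD -(gC hP) -(gC gP) projC.
rewrite addr_ge0 ?(semi_ge0 hP) //.
by rewrite g_proj_self // (semi_ge0 gP).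
Qed.

Lemma coercive_formP z x : normc z = 1 ->
  dl * nm x ^+ 2 <= Re (coercive_form z x x).
Proof.
move=> z1; have hP := contact_form_semi_inner z1.
pose p := P x; pose q := x - p.
have qE : orth g q E by exact: orth_proj.
have gpx : Re (g (P x) x) = nm p ^+ 2.
  by rewrite (nm_sqr gP) g_proj_self.
have xpq : nm x ^+ 2 = nm q ^+ 2 + nm p ^+ 2.
  rewrite -[in LHS](subrK p x) (nm_sqrD gP) (orth_projr _ qE) /=.
  by rewrite mulr0 addr0.
have qd : (1 - r) * nm q ^+ 2 <= snm (contact_form z) q ^+ 2.
  rewrite (nm_sqr hP) contact_form_diag.
  have := Re_le_normc (z^* * g (T q) q).
  rewrite normcM normc_conj z1 mul1r; have := Er qE; lra.
have qh := nmB_le hP x p; have pl := contact_form_le p z1.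
have hx := nm_sqr hP x; have h0 := nm_ge0 (contact_form z) x.
have h1 := nm_ge0 (contact_form z) p; have h2 := nm_ge0 (contact_form z) q.
have p0 := nm_ge0 g p.
have pdiag : snm (contact_form z) p ^+ 2 <= 2 * nm p ^+ 2.
  rewrite (nm_sqr hP) contact_form_diag.
  have := normc_Re_ge (z^* * g (T p) p).
  rewrite normcM normc_conj z1 mul1r; have := numradius p; lra.
have step : (1 - r) * nm q ^+ 2 <=
    2 * Re (contact_form z x x) + 4 * nm p ^+ 2.
  have s1 : snm (contact_form z) q ^+ 2 <=
      2 * snm (contact_form z) x ^+ 2 + 2 * snm (contact_form z) p ^+ 2.
    rewrite -/q in qh.
    have s2 : snm (contact_form z) q ^+ 2 <=
      (snm (contact_form z) x + snm (contact_form z) p) ^+ 2.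
      by rewrite lerXn2r ?nnegrE // addr_ge0.
    apply: le_trans s2 _; rewrite sqrrD.
    have := sqr_ge0 (snm (contact_form z) x - snm (contact_form z) p).
    rewrite sqrrB; lra.
  rewrite -hx; lra.
rewrite /coercive_form ReD gpx xpq mulrC ler_pdivrMr; last first.
  by rewrite addr_gt0 // divr_gt0 // subr_gt0.
have h3 : 0 <= Re (contact_form z x x) by rewrite -hx sqr_ge0.
have d0 : 0 < 1 - r by rewrite subr_gt0.
have step' : nm q ^+ 2 <= (2 * Re (contact_form z x x) + 4 * nm p ^+ 2) / (1 - r).
  by rewrite ler_pdivlMr // mulrC.
have p2 := sqr_ge0 (nm p).
set H := Re _ in step' h3 *.
have -> : (H + nm p ^+ 2) * (1 + 4 / (1 - r)) =
  H + nm p ^+ 2 + (2 * H + 4 * nm p ^+ 2) / (1 - r) + 2 * H / (1 - r).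
  by field; rewrite gt_eqF.
have : 0 <= 2 * H / (1 - r) by rewrite divr_ge0 ?mulr_ge0 // ltW.
lra.
Qed.

Lemma coercive_form_le z x : normc z = 1 ->
  snm (coercive_form z) x <= 3 * nm x.
Proof.
move=> z1; have hP := contact_form_semi_inner z1.
have aP := coercive_form_semi_inner z1.
rewrite -ler_sqr ?nnegrE ?mulr_ge0 ?nm_ge0 // (nm_sqr aP) ReD -(nm_sqr hP).
have h1 : snm (contact_form z) x ^+ 2 <= (2 * nm x) ^+ 2.
  by rewrite lerXn2r ?nnegrE ?mulr_ge0 ?nm_ge0 ?contact_form_le.
have h2 : Re (g (P x) x) <= nm x ^+ 2.
  apply: le_trans (Re_le_normc _) _; apply: le_trans (cauchy_schwarz gP _ _) _.
  by rewrite expr2 ler_wpM2r ?nm_ge0 ?nm_proj.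
move: h1; rewrite !exprMn; have := sqr_ge0 (nm x); lra.
Qed.

Lemma nm_le_coercive z x : normc z = 1 ->
  nm x <= (Num.sqrt dl)^-1 * snm (coercive_form z) x.
Proof.
move=> z1; have aP := coercive_form_semi_inner z1.
have sd : 0 < Num.sqrt dl by rewrite sqrtr_gt0 coercivity_gt0.
rewrite mulrC ler_pdivlMr // mulrC.
rewrite -ler_sqr ?nnegrE ?mulr_ge0 ?nm_ge0 ?(ltW sd) // exprMn.
by rewrite sqr_sqrtr ?(ltW coercivity_gt0) // (nm_sqr aP) coercive_formP.
Qed.

(** The semi-norms of [g] and of the coercive form are equivalent. *)
Lemma coercive_form_complete z : normc z = 1 -> nm_complete (coercive_form z).
Proof.
move=> z1 u uC.
have sd : 0 < Num.sqrt dl by rewrite sqrtr_gt0 coercivity_gt0.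
have [x xP] : exists x, forall e, 0 < e ->
    exists n0, forall n, (n0 <= n)%N -> nm (u n - x) <= e.
  apply: gcomp => e e0; have [n0 n0P] := uC _ (mulr_gt0 e0 sd).
  exists n0 => j k hj hk; apply: le_trans (nm_le_coercive _ z1) _.
  by rewrite mulrC ler_pdivrMr // n0P.
exists x => e e0; have [n0 n0P] := xP _ (divr_gt0 e0 (ltr0Sn _ 2)).
exists n0 => n hn; apply: le_trans (coercive_form_le _ z1) _.
by rewrite mulrC -ler_pdivlMr // n0P.
Qed.

(* On the circle this is [z] times [coercive_form z], made polynomial in [z]. *)
Definition pencil z x y : R[i] :=
  z * (g x y + g (P x) y) -
  (2^-1 : R)%:C * (g (T x) y + z ^+ 2 * g x (T y)).

Lemma pencilE z x y : normc z = 1 -> pencil z x y = z * coercive_form z x y.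
Proof.
move=> /unit_conj z1; rewrite /pencil /coercive_form /contact_form.
transitivity (z * (g x y + g (P x) y) -
  (2^-1 : R)%:C * (z * z^* * g (T x) y + z ^+ 2 * g x (T y))).
  by rewrite z1 mul1r.
by ring.
Qed.

Lemma pencilPl z a x y w :
  pencil z (a *: x + y) w = a * pencil z x w + pencil z y w.
Proof. by rewrite /pencil Tlin proj_lin !(gPl gP); ring. Qed.

Lemma pencil0l z y : pencil z 0 y = 0.
Proof.
have := pencilPl z (-1) 0 0 y.
by rewrite scaler0 addr0 mulN1r addNr.
Qed.

Lemma pencilBl z x y w : pencil z (x - y) w = pencil z x w - pencil z y w.
Proof. by rewrite addrC -scaleN1r pencilPl mulN1r addrC. Qed.

Lemma pencil_suml z (I : Type) (s : seq I) (a : I -> R[i]) (f : I -> V) y :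
  pencil z (\sum_(i <- s) a i *: f i) y = \sum_(i <- s) a i * pencil z (f i) y.
Proof.
elim: s => [|i s IHs]; first by rewrite !big_nil pencil0l.
by rewrite !big_cons pencilPl IHs.
Qed.

Lemma pencil_coercive z x c : normc z = 1 -> 0 <= c ->
  (forall y, normc (pencil z x y) <= c * nm y) -> nm x <= c / dl.
Proof.
move=> z1 c0 h; rewrite ler_pdivlMr ?coercivity_gt0 //.
have [x0|x0] := eqVneq (nm x) 0.
  by rewrite x0 mul0r.
have xp : 0 < nm x by rewrite lt_neqAle eq_sym x0 nm_ge0.
rewrite -(ler_pM2r xp); apply: le_trans _ (h x).
rewrite pencilE // normcM z1 mul1r; apply: le_trans (Re_le_normc _).
by have := coercive_formP x z1; rewrite expr2 mulrA (mulrC dl).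
Qed.

Lemma pencil_solve z (phi : V -> R[i]) c : normc z = 1 -> 0 <= c ->
  (forall a x y, phi (a *: x + y) = a^* * phi x + phi y) ->
  (forall y, normc (phi y) <= c * nm y) ->
  exists x, (forall y, pencil z x y = phi y) /\ nm x <= c / dl.
Proof.
move=> z1 c0 phil phib.
have [|||x xP] := riesz (coercive_form_semi_inner z1)
  (phi := fun y => z^* * phi y) (c := c * (Num.sqrt dl)^-1).
- exact: coercive_form_complete.
- by move=> a x y; rewrite phil; ring.
- move=> y; rewrite normcM normc_conj z1 mul1r; apply: le_trans (phib y) _.
  by rewrite -mulrA ler_wpM2l ?nm_le_coercive.
have E1 y : pencil z x y = phi y.
  by rewrite pencilE // xP mulrA unit_conj // mul1r.
by exists x; split=> //; apply: (pencil_coercive z1 c0) => y; rewrite E1.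
Qed.

Definition pencil1 z x y : R[i] :=
  g x y + g (P x) y - z * g x (T y).

Definition pencil2 x y : R[i] := - ((2^-1 : R)%:C * g x (T y)).

Lemma pencil_shift z s x y :
  pencil (z + s) x y = pencil z x y + s * pencil1 z x y + s ^+ 2 * pencil2 x y.
Proof.
have h2 : (2^-1 : R)%:C * 2 = 1 :> R[i].
  by rewrite -(rmorph_nat (real_complex R)) -rmorphM /= mulVf ?pnatr_eq0.
have -> : pencil1 z x y = g x y + g (P x) y - (2^-1 : R)%:C * 2 * (z * g x (T y)).
  by rewrite h2 mul1r.
rewrite /pencil /pencil2; ring.
Qed.

Lemma pencil_bound : exists2 D : R, 1 <= D & forall z x y, normc z = 1 ->
  [/\ normc (pencil z x y) <= D * nm x * nm y,
      normc (pencil1 z x y) <= D * nm x * nm y &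
      normc (pencil2 x y) <= D * nm x * nm y].
Proof.
have [t t0 Tb] := Tbdd; exists (2 + t); first lra.
move=> z x y z1.
have x0 := nm_ge0 g x; have y0 := nm_ge0 g y.
have xy0 : 0 <= nm x * nm y by rewrite mulr_ge0.
have b1 := cauchy_schwarz gP x y.
have b2 : normc (g (P x) y) <= nm x * nm y.
  apply: le_trans (cauchy_schwarz gP _ _) _.
  by rewrite ler_wpM2r // nm_proj.
have b3 : normc (g (T x) y) <= t * (nm x * nm y).
  apply: le_trans (cauchy_schwarz gP _ _) _.
  by rewrite mulrA ler_wpM2r.
have b4 : normc (g x (T y)) <= t * (nm x * nm y).
  apply: le_trans (cauchy_schwarz gP _ _) _.
  by rewrite mulrCA ler_wpM2l.
have h2 : normc ((2^-1 : R)%:C : R[i]) = 2^-1 by rewrite normcC ger0_norm.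
have b12 := normcD_le (g x y) (g (P x) y).
rewrite -!mulrA mulrDl; split.
- apply: le_trans (normcB_le _ _) _; rewrite !normcM z1 h2 mul1r.
  have := normcD_le (g (T x) y) (z ^+ 2 * g x (T y)).
  rewrite normcM normcX z1 expr1n mul1r; lra.
- apply: le_trans (normcB_le _ _) _; rewrite normcM z1 mul1r; lra.
- rewrite normcN_eq normcM h2; have := normc_ge0 (g x (T y)); lra.
Qed.

Lemma pencil_form_antilinear z a b w u v x y :
  let phi y := g w y + (a * pencil1 z u y + b * pencil2 v y) in
  forall c : R[i], phi (c *: x + y) = c^* * phi x + phi y.
Proof.
move=> phi c; rewrite /phi /pencil1 /pencil2 (linD Tlin) (linZ Tlin).
by rewrite !(gDr gP) !(gZr gP); ring.
Qed.

(* Power series solution [\sum_k (z - z0)^k y_k] of [pencil z x = g w]. *)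
Lemma pencil_coefficients : exists C M : R, [/\ 0 <= C, 1 <= M &
  forall z0 w, normc z0 = 1 -> exists yy : nat -> V,
    (forall k, nm (yy k) <= C * nm w * M ^+ k) /\
    forall z n, normc z = 1 -> forall y,
      normc (g w y - pencil z (\sum_(k < n) (z - z0) ^+ k *: yy k) y)
        <= C * nm w * (M * normc (z - z0)) ^+ n * nm y].
Proof.
have [D D1 DP] := pencil_bound.
have dl0 := coercivity_gt0; have dl1 := coercivity_le1.
have D0 : 0 <= D by lra.
(* Each new coefficient is bounded by D/dl times the sum of the two preceding bounds. *)
pose M := 2 * D / dl.
have M1 : 1 <= M by rewrite /M ler_pdivlMr //; lra.
have M0 : 0 <= M by lra.
have step z0 (w : V) : normc z0 = 1 -> exists nxt : V * V -> V, forall p,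
    (forall y, pencil z0 (nxt p) y = - pencil1 z0 p.1 y - pencil2 p.2 y) /\
    nm (nxt p) <= D * (nm p.1 + nm p.2) / dl.
  move=> z01; suff h p : exists x, (forall y, pencil z0 x y =
    - pencil1 z0 p.1 y - pencil2 p.2 y) /\ nm x <= D * (nm p.1 + nm p.2) / dl.
    by have [nxt ?] := choice h; exists nxt.
  case: p => u v /=.
  apply: pencil_solve => // [|a x y|y].
  - by rewrite mulr_ge0 ?addr_ge0 ?nm_ge0.
  - have := pencil_form_antilinear z0 (-1) (-1) 0 u v x y a.
    by rewrite !(g0l gP) !add0r !mulN1r.
  - apply: le_trans (normcB_le _ _) _; rewrite normcN_eq.
    by have [_ h1 _] := DP z0 u y z01; have [_ _ h2] := DP z0 v y z01; lra.
(* The residual has two terms; the second carries an extra factor |z - z0| <= 2, whence 1 + 2. *)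
pose C := 3 * D / dl.
have C1 : dl^-1 <= C.
  have dli : 0 < dl^-1 by rewrite invr_gt0.
  rewrite /C -[leLHS]mul1r (ler_pM2r dli); lra.
have C0 : 0 <= C by rewrite /C divr_ge0 ?mulr_ge0 // ltW.
exists C, M; split=> //.
move=> z0 w z01; have [nxt nxtP] := step z0 w z01.
have [x0 [x0P x0b]] : exists x, (forall y, pencil z0 x y = g w y) /\ nm x <= nm w / dl.
  apply: pencil_solve => //; first exact: nm_ge0.
    by move=> a x y; rewrite (gDr gP) (gZr gP).
  by move=> y; exact: cauchy_schwarz.
(* Pairs (y_k, y_(k-1)), started with y_(-1) = 0. *)
pose pr k := iter k (fun p => (nxt p, p.1)) (x0, 0).
pose yy k := (pr k).1; pose zz k := (pr k).2.
pose Y := nm w / dl.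
have Y0 : 0 <= Y by rewrite divr_ge0 ?nm_ge0 // ltW.
have yyP k : nm (yy k) <= Y * M ^+ k /\ nm (zz k) <= Y * M ^+ k.
  elim: k => [|k [IH1 IH2]]; first by rewrite expr0 mulr1 /yy /zz /= (nm0 gP).
  have MS : Y * M ^+ k <= Y * M ^+ k.+1.
    by rewrite ler_wpM2l // exprS ler_peMl // exprn_ge0.
  split; last by rewrite /zz /pr iterS /=; apply: le_trans MS.
  rewrite /yy /pr iterS /= -/(pr k).
  have [_ h] := nxtP (pr k); apply: le_trans h _.
  rewrite ler_pdivrMr // exprS /M.
  have -> : Y * (2 * D / dl * M ^+ k) * dl = D * (Y * M ^+ k + Y * M ^+ k).
    by field; rewrite gt_eqF.
  by rewrite ler_wpM2l // lerD.
exists yy; split=> [k|z n z1 y].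
  have [h _] := yyP k; apply: le_trans h _.
  rewrite ler_wpM2r ?exprn_ge0 // /Y mulrC ler_wpM2r ?nm_ge0 //.
set s := z - z0.
have zs : z = z0 + s by rewrite /s addrC subrK.
(* The recursion cancels all inner powers of s; only the last two coefficients contribute to the
   residual. *)
have res k : pencil z (\sum_(i < k) s ^+ i *: yy i) y =
    g w y - s ^+ k * pencil z0 (yy k) y + s ^+ k.+1 * pencil2 (zz k) y.
  elim: k => [|k IHk].
    rewrite big_ord0 /yy /zz /= x0P expr0 mul1r subrr add0r expr1.
    by rewrite pencil0l /pencil2 (g0l gP) !mulr0 oppr0 mulr0.
  rewrite big_ord_recr /= addrC pencilPl IHk {1}zs pencil_shift.
  have [h _] := nxtP (pr k).
  rewrite /yy /zz /pr !iterS /= -/(pr k) -/(yy k) h -/(yy k) -/(zz k) !exprS.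
  by ring.
rewrite res.
have -> : g w y - (g w y - s ^+ n * pencil z0 (yy n) y + s ^+ n.+1 * pencil2 (zz n) y) =
  s ^+ n * pencil z0 (yy n) y - s ^+ n.+1 * pencil2 (zz n) y.
  by move: (s ^+ n.+1) (s ^+ n) => a b; ring.
have [h1 _ _] := DP z0 (yy n) y z01; have [_ _ h2] := DP z0 (zz n) y z01.
apply: le_trans (normcB_le _ _) _; rewrite !normcM !normcX.
set q := normc s.
have q0 : 0 <= q by exact: normc_ge0.
have q2 : q <= 2 by have := normcB_le z z0; rewrite z1 z01 -/s -/q; lra.
have [hy hz] := yyP n.
have y0 := nm_ge0 g y.
have B1 : normc (pencil z0 (yy n) y) <= D * (Y * M ^+ n) * nm y.
  by apply: le_trans h1 _; rewrite ler_wpM2r // ler_wpM2l.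
have B2 : normc (pencil2 (zz n) y) <= D * (Y * M ^+ n) * nm y.
  by apply: le_trans h2 _; rewrite ler_wpM2r // ler_wpM2l.
have qn : 0 <= q ^+ n by rewrite exprn_ge0.
have B0 : 0 <= D * (Y * M ^+ n) * nm y.
  by do 3!apply: mulr_ge0 => //; exact: exprn_ge0.
apply: le_trans (_ : 3 * (q ^+ n * (D * (Y * M ^+ n) * nm y)) <= _).
  have e1 := ler_wpM2l qn B1.
  have e2 : q ^+ n.+1 * normc (pencil2 (zz n) y) <=
      2 * (q ^+ n * (D * (Y * M ^+ n) * nm y)).
    by rewrite exprS -mulrA ler_pM ?mulr_ge0 ?normc_ge0 // ler_wpM2l.
  lra.
rewrite [(M * q) ^+ n]exprMn /C /Y le_eqVlt; apply/orP; left; apply/eqP.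
by field; rewrite gt_eqF.
Qed.

(** The difference between [rho z] and a partial sum has a small image under the pencil, so
    coercivity makes the difference itself small. *)
Lemma pencil_solution_analytic (w v : V) (rho : R[i] -> V) :
  (forall z, normc z = 1 -> forall y, pencil z (rho z) y = g w y) ->
  circle_analytic (fun z => g (rho z) v).
Proof.
move=> rhoP; have [C [M [C0 M1 CM]]] := pencil_coefficients.
have dl0 := coercivity_gt0; have dl1 := coercivity_le1.
have w0 := nm_ge0 g w; have v0 := nm_ge0 g v.
pose B := C * nm w / dl * nm v.
have B0 : 0 <= B by rewrite !mulr_ge0 // invr_ge0 ltW.
exists B, M; split=> // z0 z01; have [yy [yyb yyP]] := CM z0 w z01.
exists (fun k => g (yy k) v); split=> [k|z z1 n].
  apply: le_trans (cauchy_schwarz gP _ _) _.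
  rewrite /B mulrAC ler_wpM2r //; apply: le_trans (yyb k) _.
  rewrite ler_wpM2r ?exprn_ge0 // ?(le_trans ler01) //.
  by rewrite ler_pdivlMr // ler_piMr // mulr_ge0.
pose S := \sum_(k < n) (z - z0) ^+ k *: yy k.
have -> : g (rho z) v - \sum_(k < n) g (yy k) v * (z - z0) ^+ k = g (rho z - S) v.
  rewrite (gBl gP) (g_suml gP); congr (_ - _); apply: eq_bigr => k _.
  by rewrite (gZl gP) mulrC.
apply: le_trans (cauchy_schwarz gP _ _) _.
rewrite /B mulrAC ler_wpM2r //.
have q0 : 0 <= (M * normc (z - z0)) ^+ n.
  by rewrite exprn_ge0 // mulr_ge0 ?normc_ge0 // (le_trans ler01).
rewrite mulrAC; apply: (pencil_coercive z1) => [|y].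
  by apply: mulr_ge0 => //; exact: mulr_ge0.
have -> : pencil z (rho z - S) y = g w y - pencil z S y.
  by rewrite pencilBl rhoP.
exact: yyP.
Qed.

(* [contact_form z] is a perturbation of [coercive_form z] of rank [m], so
   whether it has a kernel is decided by an [m x m] determinant. *)
Lemma contact_determinant : exists f : R[i] -> R[i],
  [/\ circle_analytic f,
      forall z, normc z = 1 -> f z = 0 ->
        exists x, nm x = 1 /\ forall y, contact_form z x y = 0 &
      forall z, normc z = 1 -> f z <> 0 ->
        exists2 c : R, 0 < c & forall x, c * nm x ^+ 2 <= Re (contact_form z x x)].
Proof.
have [rho rhoP] : exists rho : 'I_m -> R[i] -> V,
    forall i z, normc z = 1 -> forall y, pencil z (rho i z) y = g E`_i y.
  suff h (i : 'I_m) : exists h : R[i] -> V, forall z, normc z = 1 ->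
      forall y, pencil z (h z) y = g E`_i y.
    by have [rho ?] := choice h; exists rho.
  suff h z : exists x, normc z = 1 -> forall y, pencil z x y = g E`_i y.
    by have [k ?] := choice h; exists k.
  (* Off the circle 0 is a mere placeholder. *)
  have [z1|nz1] := pselect (normc z = 1); last by exists 0.
  have [|||x [xP _]] := pencil_solve (phi := g E`_i) (c := nm E`_i) z1.
  - exact: nm_ge0.
  - by move=> a x y; rewrite (gDr gP) (gZr gP).
  - by move=> y; exact: cauchy_schwarz.
  by exists x.
(* A kernel vector x of the contact form equals sum_i z g(x, e_i) rho_i up to null vectors; pairing
   with e_j gives [u *m F z = 0] for its row u of coordinates g(x, e_i). *)
pose F z : 'M[R[i]]_m := \matrix_(i, j) ((i == j)%:R - z * g (rho i z) E`_j).
exists (fun z => \det (F z)); split.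
- apply: circle_analytic_det => i j.
  apply: (@circle_analytic_ext _
    (fun z => (i == j)%:R + (-1) * (z * g (rho i z) E`_j))).
    by move=> z _; rewrite mxE mulN1r.
  apply: circle_analyticD; first exact: circle_analytic_cst.
  apply: circle_analyticM; first exact: circle_analytic_cst.
  apply: circle_analyticM; first exact: circle_analytic_id.
  exact: pencil_solution_analytic (rhoP i).
- move=> z z1 /eqP/det0P[u u0 uF].
  have z0 : z != 0 by rewrite -normc_eq0 z1 oner_eq0.
  pose x := \sum_i (z * u 0 i) *: rho i z.
  have xE (j : 'I_m) : g x E`_j = u 0 j.
    have := congr1 (fun A : 'rV_m => A 0 j) uF; rewrite !mxE.
    rewrite (eq_bigr (fun i => u 0 i * (i == j)%:R - z * u 0 i * g (rho i z) E`_j)).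
      rewrite sumrB (bigD1 j) //= eqxx mulr1 big1 ?addr0 => [|i /negbTE->].
        move/eqP; rewrite subr_eq0 => /eqP ->.
        by rewrite (g_suml gP); apply: eq_bigr => i _; rewrite (gZl gP).
      by rewrite mulr0.
    by move=> i _; rewrite mxE; ring.
  have xk y : contact_form z x y = 0.
    have : pencil z x y = z * g (P x) y.
      rewrite g_projl mulr_sumr {1}/x.
      rewrite pencil_suml; apply: eq_bigr => i _.
      by rewrite -/x xE mulrA rhoP.
    rewrite pencilE // /coercive_form => /(mulfI z0)/eqP.
    by rewrite -subr_eq0 addrK => /eqP.
  have x0 : nm x != 0.
    apply: contraNneq u0 => x0; apply/eqP/rowP => j.
    by rewrite mxE -xE (g_null gP).
  exists ((nm x)^-1%:C *: x); split; first exact: normalize.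
  move=> y; have hP := contact_form_semi_inner z1.
  by rewrite (gZl hP) xk mulr0.
move=> z z1 /eqP Fz.
have hP := contact_form_semi_inner z1; have aP := coercive_form_semi_inner z1.
have z0 : z != 0 by rewrite -normc_eq0 z1 oner_eq0.
have Fu : F z \in unitmx by rewrite unitmxE unitfE.
pose S := \sum_i \sum_j normc (invmx (F z) j i) * nm (rho i z).
have S0 : 0 <= S.
  by rewrite sumr_ge0 // => i _; rewrite sumr_ge0 // => j _; rewrite mulr_ge0 ?normc_ge0 ?nm_ge0.
have dl0 := coercivity_gt0.
pose k := (1 + S) * 2 / dl.
have k0 : 0 < k by rewrite divr_gt0 // mulr_gt0 //; lra.
exists (k ^+ 2)^-1; first by rewrite invr_gt0 exprn_gt0.
move=> x; rewrite mulrC ler_pdivrMr ?exprn_gt0 // mulrC -(nm_sqr hP) -exprMn.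
rewrite lerXn2r ?nnegrE ?nm_ge0 ?(mulr_ge0 (ltW k0) (nm_ge0 _ _)) //.
pose u : 'rV[R[i]]_m := \row_i g x E`_i.
(* The pencil sends x' to z times the contact form at x, so x' is controlled by that form. The
   coordinates [u] are recovered from x' through the inverse of [F z], and then x from x' and
   [u]. *)
pose x' := x - \sum_i (z * u 0 i) *: rho i z.
have x'b : nm x' <= 2 * snm (contact_form z) x / dl.
  apply: (pencil_coercive z1) => [|y]; first by rewrite mulr_ge0 ?nm_ge0.
  have -> : pencil z x' y = z * contact_form z x y.
    rewrite pencilBl pencilE // /coercive_form mulrDr g_projl pencil_suml.
    rewrite mulr_sumr; apply/eqP; rewrite subr_eq; apply/eqP; congr (_ + _).
    by apply: eq_bigr => i _; rewrite rhoP // mxE mulrA.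
  rewrite normcM z1 mul1r; apply: le_trans (cauchy_schwarz hP _ _) _.
  apply: le_trans (ler_wpM2l (nm_ge0 _ _) (contact_form_le y z1)) _.
  by rewrite mulrCA mulrA.
have x'E (j : 'I_m) : (u *m F z) 0 j = g x' E`_j.
  rewrite mxE (gBl gP) (g_suml gP).
  rewrite (eq_bigr (fun i => u 0 i * (i == j)%:R - g ((z * u 0 i) *: rho i z) E`_j)).
    rewrite sumrB (bigD1 j) //= eqxx mulr1 big1 ?addr0 => [|i /negbTE->].
      by rewrite [u 0 j]mxE.
    by rewrite mulr0.
  by move=> i _; rewrite [F z i j]mxE (gZl gP); ring.
have E1 (j : 'I_m) : nm E`_j = 1.
  rewrite /snm EO // eqxx /= sqrtr1 //.
have ub i : normc (u 0 i) <= nm x' * \sum_j normc (invmx (F z) j i).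
  rewrite -[u](mulmxK Fu) mxE; apply: le_trans (sum_normc_le _ _) _.
  rewrite mulr_sumr; apply: ler_sum => j _; rewrite normcM ler_wpM2r ?normc_ge0 //.
  by rewrite x'E; apply: le_trans (cauchy_schwarz gP _ _) _; rewrite E1 mulr1.
have xb : nm x <= nm x' * (1 + S).
  rewrite -(subrK (\sum_i (z * u 0 i) *: rho i z) x) -/x'.
  apply: le_trans (nmD_le gP _ _) _; rewrite mulrDr mulr1 lerD2l.
  apply: le_trans (nm_sum_le gP _ _) _; rewrite mulr_sumr; apply: ler_sum => i _.
  rewrite (nmZ gP) normcM z1 mul1r -mulr_suml mulrA ler_wpM2r ?nm_ge0 //.
have S1 : 0 <= 1 + S by lra.
apply: le_trans xb _; apply: le_trans (ler_wpM2r S1 x'b) _.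
by rewrite /k le_eqVlt; apply/orP; left; apply/eqP; ring.
Qed.

End NumericalRange.

(** * From the circle to the disc *)

Section CircleLimitPoint.
Variable R : realType.

Lemma infinite_Re (Z : set R[i]) : infinite_set Z ->
  (forall z, Z z -> normc z = 1) -> infinite_set [set Re z | z in Z].
Proof.
move=> Zinf Z1 finRe; apply: Zinf.
pose k (p : R * bool) : R[i] :=
  (p.1 +i* (if p.2 then Num.sqrt (1 - p.1 ^+ 2) else - Num.sqrt (1 - p.1 ^+ 2)))%C.
have fin2 := finite_setX finRe (@finite_finset _ [set: bool]).
apply: sub_finite_set (finite_image k fin2) => z Zz.
exists (Re z, 0 <= Im z); first by split=> //; exists z.
have : Re z ^+ 2 + Im z ^+ 2 = 1 by rewrite -normc_sqr Z1 // expr1n.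
rewrite /k; case: z Zz => a b _ /= h.
have -> : 1 - a ^+ 2 = b ^+ 2 by lra.
rewrite sqrtr_sqr; case: leP => b0; first by rewrite ger0_norm.
by rewrite ltr0_norm ?opprK.
Qed.

(** Bolzano-Weierstrass on the real parts gives a limit x0. If neither point of the circle above x0
    were a limit point, points of Z with real part near x0 but different from it would contradict
    this at the one matching the sign of their imaginary part. *)
Lemma circle_limit_point (Z : set R[i]) : infinite_set Z ->
  (forall z, Z z -> normc z = 1) ->
  exists z0, normc z0 = 1 /\
    forall e, 0 < e -> exists z, Z z /\ 0 < normc (z - z0) < e.
Proof.
move=> Zinf Z1.
have Rb : bounded_set [set Re z | z in Z].
  exists 1; split; first exact: num_real.
  move=> M M1 _ [z /Z1 z1 <-]; apply: le_trans (ltW M1).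
  by rewrite ler_norml -z1 Re_le_normc normc_Re_ge.
have [x0 x0P] : exists x0 : R, limit_point [set Re z | z in Z] x0 :=
  infinite_bounded_limit_point_nonempty (infinite_Re Zinf Z1) Rb.
have close (d : R) : 0 < d -> exists z, [/\ Z z, Re z != x0 & `|Re z - x0| < d].
  move=> d0; have [y [yx [z Zz zy] yd]] := x0P _ (nbhsx_ballx x0 d d0).
  exists z; split; rewrite ?zy //.
  by move: yd; rewrite /ball /= distrC.
have x0n : `|x0| <= 1.
  apply/ler_addgt0Pr => e e0; have [z [/Z1 z1 _ h]] := close e e0.
  have h2 : `|Re z| <= 1 by rewrite ler_norml -z1 Re_le_normc normc_Re_ge.
  have := ler_normB (Re z) (Re z - x0); rewrite subKr; lra.
have x01 : x0 ^+ 2 <= 1 by rewrite -real_normK ?num_real // expr_le1.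
pose y0 := Num.sqrt (1 - x0 ^+ 2).
have y00 : 0 <= y0 := sqrtr_ge0 _.
have y02 : y0 ^+ 2 = 1 - x0 ^+ 2 by rewrite sqr_sqrtr // subr_ge0.
apply: contrapT => /forallNP nacc.
have far (z0 : R[i]) : normc z0 = 1 -> exists e, 0 < e /\
    forall z, Z z -> 0 < normc (z - z0) -> e <= normc (z - z0).
  move=> z01; have /not_andP[//|/existsNP[e /not_implyP[e0 /forallNP h]]] := nacc z0.
  exists e; split=> // z Zz zp; rewrite leNgt; apply/negP => ze.
  by apply: (h z); rewrite zp ze.
have n1 (s : R) : s ^+ 2 = 1 -> normc (x0 +i* (s * y0))%C = 1.
  move=> s1; apply/eqP; rewrite -sqrp_eq1 ?normc_ge0 // normc_sqr /=.
  by rewrite exprMn s1 mul1r y02 addrC subrK.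
have [e1 [e10 h1]] := far _ (n1 1 (expr1n _ _)).
have [e2 [e20 h2]] := far _ (n1 (-1) ltac:(by rewrite sqrrN expr1n)).
pose e := Num.min e1 e2; have e0 : 0 < e by rewrite lt_min e10.
(* The squared distance is less than d from the real parts plus 3 d from the imaginary parts. *)
pose d := Num.min 1 (e ^+ 2 / 4).
have d0 : 0 < d by rewrite lt_min ltr01 divr_gt0 ?exprn_gt0.
have d1 : d <= 1 by rewrite ge_min lexx.
have d2 : d <= e ^+ 2 / 4 by rewrite ge_min lexx orbT.
have [z [Zz zx zd]] := close d d0.
have [s [s1 sIm]] : exists s : R, s ^+ 2 = 1 /\ Im z = s * `|Im z|.
  have [b0|b0] := leP 0 (Im z).
    by exists 1; rewrite expr1n mul1r ger0_norm.
  by exists (-1); rewrite sqrrN expr1n ltr0_norm // mulrNN mul1r.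
have zI : `|Im z| ^+ 2 = 1 - Re z ^+ 2.
  rewrite real_normK ?num_real //.
  have := normc_sqr z; rewrite Z1 // expr1n; lra.
have dist : normc (z - (x0 +i* (s * y0))%C) ^+ 2 =
    (Re z - x0) ^+ 2 + (`|Im z| - y0) ^+ 2.
  rewrite normc_sqr; move: sIm; case: z {Zz zx zd zI} => a b /= ->.
  by rewrite -mulrBr exprMn s1 mul1r normrM normr_id; congr (_ + (_ - _) ^+ 2);
     rewrite -[LHS]mul1r; congr (_ * _); apply/esym/eqP; rewrite -sqrp_eq1 // real_normK ?num_real // s1.
have pos : 0 < normc (z - (x0 +i* (s * y0))%C).
  rewrite lt_neqAle normc_ge0 andbT eq_sym; apply/eqP => h; move: dist.
  rewrite h expr0n /= => /esym/eqP; rewrite paddr_eq0 ?sqr_ge0 // sqrf_eq0 subr_eq0.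
  by rewrite (negbTE zx).
have small : normc (z - (x0 +i* (s * y0))%C) < e.
  rewrite -ltr_sqr ?nnegrE ?normc_ge0 ?(ltW e0) // dist.
  have b0 : 0 <= `|Im z| by [].
  have le1 : (`|Im z| - y0) ^+ 2 <= `| `|Im z| ^+ 2 - y0 ^+ 2|.
    rewrite subr_sqr normrM -real_normK ?num_real // expr2 ler_wpM2l //.
    by rewrite (ger0_norm (addr_ge0 b0 y00)) ler_norml; lra.
  have le2 : `| `|Im z| ^+ 2 - y0 ^+ 2| <= d * 3.
    rewrite zI y02 opprB addrC addrA subrK subr_sqr normrM.
    rewrite -opprB normrN; apply: ler_pM => //; first exact: ltW.
    apply: le_trans (ler_normD _ _) _.
    have : `|Re z| <= 1 by rewrite ler_norml -(Z1 _ Zz) Re_le_normc normc_Re_ge.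
    lra.
  have le3 : (Re z - x0) ^+ 2 < d.
    rewrite -real_normK ?num_real //; have := normr_ge0 (Re z - x0); nra.
  lra.
have : s = 1 \/ s = -1 by move/eqP: s1; rewrite sqrf_eq1 => /orP[]/eqP; [left|right].
case=> sE; rewrite sE in pos small.
- by have := h1 z Zz pos; move: small; rewrite lt_min ltNge => /andP[/negP]; lra.
- by have := h2 z Zz pos; move: small; rewrite lt_min => /andP[_]; rewrite ltNge => /negP.
Qed.

End CircleLimitPoint.

(** * Convexity of the numerical range *)

Section NumericalRangeConvex.
Variables (R : realType) (V : lmodType R[i]) (g : V -> V -> R[i]).
Hypotheses (gP : semi_inner g).
Local Notation nm := (snm g).
Variable T : V -> V.
Hypotheses (Tlin : lin T) (Tbdd : bdd g T).

Definition in_range (w : R[i]) := exists x, nm x = 1 /\ g (T x) x = w.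

(* Toeplitz-Hausdorff: after an affine change the two values are 0 and 1, and
   a phase makes the cross terms real, leaving a real quadratic equation. *)
Lemma numerical_range_convex a b (t : R) : in_range a -> in_range b ->
  0 <= t -> t <= 1 -> in_range ((1 - t)%:C * a + t%:C * b).
Proof.
move=> Wa Wb; rewrite le_eqVlt => /orP[/eqP<- _|t0].
  by rewrite subr0 mul1r mul0r addr0.
rewrite le_eqVlt => /orP[/eqP->|t1].
  by rewrite subrr mul1r mul0r add0r.
have [<-|ab] := eqVneq a b.
  by rewrite -mulrDl -rmorphD /= subrK mul1r.
have [x [x1 xa]] := Wa; have [y [y1 yb]] := Wb.
have ba : b - a != 0 by rewrite subr_eq0 eq_sym.
(* The form of (T - a)/(b - a), with values 0 at [x] and 1 at [y]. *)
pose s u v := (g (T u) v - a * g u v) / (b - a).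
have sDl c u v w : s (c *: u + v) w = c * s u w + s v w.
  by rewrite /s Tlin !(gPl gP); ring.
have sDr c u v w : s w (c *: u + v) = c^* * s w u + s w v.
  by rewrite /s !(gDr gP) !(gZr gP); ring.
have sxx : s x x = 0 by rewrite /s xa (gxxE gP) x1 expr1n mulr1 subrr mul0r.
have syy : s y y = 1 by rewrite /s yb (gxxE gP) y1 expr1n mulr1 divff.
have [mu [mu1 muI]] : exists mu, normc mu = 1 /\
    Im (mu * s x y + mu^* * s y x) = 0.
  pose p := s x y - (s y x)^*.
  have E mu : Im (mu * s x y + mu^* * s y x) = Im (mu * p).
    rewrite /p; case: mu (s x y) (s y x) => [m1 m2] [a1 a2] [b1 b2] /=; ring.
  have [p0|p0] := eqVneq p 0.
    by exists 1; rewrite normc1 E p0 mulr0.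
  exists (p^* / (normc p)%:C).
  have np : normc p != 0 by rewrite normc_eq0.
  split; first by rewrite normcM normcV normc_conj normcC ger0_norm ?normc_ge0 // divff.
  by rewrite E mulrAC [p^* * p]mulrC mulc_conj -rmorphV ?unitfE // -rmorphM.
pose ka := Re (mu * s x y + mu^* * s y x).
have kaE : mu * s x y + mu^* * s y x = ka%:C by apply: complex_ext.
pose et := Re (mu * g x y).
(* For v = mu x + ta y, the equation s(v, v) = t |v|^2 is (1 - t) ta^2 + be ta - t = 0; its outer
   coefficients have opposite signs, so it has a real root. *)
pose be := ka - 2 * t * et.
pose D := be ^+ 2 + 4 * (1 - t) * t.
have D0 : 0 <= D.
  by rewrite addr_ge0 ?sqr_ge0 // !mulr_ge0 // ?subr_ge0 ltW.
pose ta := (Num.sqrt D - be) / (2 * (1 - t)).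
have root : (1 - t) * ta ^+ 2 + be * ta - t = 0.
  have t1n : 1 - t != 0 by rewrite subr_eq0 gt_eqF.
  have -> : (1 - t) * ta ^+ 2 + be * ta - t = (Num.sqrt D ^+ 2 - D) / (4 * (1 - t)).
    by rewrite /ta /D; field.
  by rewrite sqr_sqrtr // subrr mul0r.
pose v := mu *: x + ta%:C *: y.
have sv : s v v = (ta ^+ 2 + ta * ka)%:C.
  rewrite /v sDl !sDr.
  have sZ c u w : s u (c *: w) = c^* * s u w.
    have s0 : s u 0 = 0 by rewrite /s !(g0r gP) mulr0 subrr mul0r.
    by have := sDr c w 0 u; rewrite addr0 s0 addr0.
  have sZl c u w : s (c *: u) w = c * s u w.
    have s0 : s 0 w = 0 by rewrite /s (lin0 Tlin) !(g0l gP) mulr0 subrr mul0r.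
    by have := sDl c u 0 w; rewrite addr0 s0 addr0.
  rewrite !sZ !sZl sxx syy conj_realC rmorphD !rmorphM /= -kaE; ring.
have nv : nm v ^+ 2 = 1 + 2 * ta * et + ta ^+ 2.
  rewrite /v (nm_sqrD gP) !(nmZ gP) x1 y1 mu1 normcC (gZl gP) (gZr gP) conj_realC.
  rewrite mulrCA ReCM -/et !mulr1 expr1n real_normK ?num_real //; ring.
(* If v were null, ta y would equal -mu x up to a null vector; comparing values of s gives ta^2 = 0,
   and then |v| = |x| = 1. *)
have vn0 : nm v != 0.
  apply/eqP => v0.
  have sv0l w : s v w = 0.
    rewrite /s !(g_null gP) ?mulr0 ?subrr ?mul0r //.
    have [c _ h] := Tbdd; apply/eqP; rewrite eq_le nm_ge0 andbT.
    by apply: le_trans (h v) _; rewrite v0 mulr0.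
  have sv0r w : s w v = 0.
    by rewrite /s (gC gP v) (gC gP v w) !(g_null gP) ?conjC0 ?mulr0 ?subrr ?mul0r.
  have yv : ta%:C *: y = - mu *: x + v by rewrite /v scaleNr addKr.
  have h : s (ta%:C *: y) (ta%:C *: y) = 0.
    by rewrite yv sDl sv0l sDr sv0r sxx !(mulr0, addr0).
  have t0' : ta = 0.
    move: h; rewrite -[ta%:C *: y]addr0 sDl sDr.
    have s0 w : s 0 w = 0 by rewrite /s (lin0 Tlin) !(g0l gP) mulr0 subrr mul0r.
    have s0r w : s w 0 = 0 by rewrite /s !(g0r gP) mulr0 subrr mul0r.
    rewrite s0 s0r syy !addr0 conj_realC mulr1 -rmorphM /= => /complexI/eqP.
    by rewrite mulf_eq0 orbb => /eqP.
  move: nv; rewrite v0 t0' expr0n /= mulr0 mul0r !addr0 => /eqP.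
  by rewrite eq_sym oner_eq0.
exists ((nm v)^-1%:C *: v); split; first exact: normalize.
rewrite (linZ Tlin) (gZl gP) (gZr gP) conj_realC mulrA -rmorphM /= -expr2 exprVn.
have nv2 : nm v ^+ 2 != 0 by rewrite expf_eq0.
have gv : g (T v) v = (a + t%:C * (b - a)) * (nm v ^+ 2)%:C.
  have : s v v * (b - a) = t%:C * (nm v ^+ 2)%:C * (b - a).
    rewrite sv -rmorphM /= nv; congr (_ %:C * _); move: root; rewrite /be; lra.
  by rewrite /s divfK // (gxxE gP) => /eqP; rewrite subr_eq => /eqP ->; ring.
rewrite gv mulrCA -rmorphM /= mulVf // mulr1 rmorphB /=; ring.
Qed.

(** A point of the disc lies on the vertical chord through it, whose endpoints are on the circle;
    the chord degenerates at 1 and -1. *)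
Lemma circle_range_disc : (forall z, normc z = 1 -> in_range z) ->
  forall w, normc w <= 1 -> in_range w.
Proof.
move=> circ w w1; pose h := Num.sqrt (1 - Re w ^+ 2).
have w2 : Re w ^+ 2 + Im w ^+ 2 <= 1.
  by rewrite -normc_sqr expr_le1 // normc_ge0.
have h0 : 0 <= h := sqrtr_ge0 _.
have h2 : h ^+ 2 = 1 - Re w ^+ 2.
  by rewrite sqr_sqrtr // subr_ge0; have := sqr_ge0 (Im w); lra.
have Wc (k : R) : k ^+ 2 = h ^+ 2 -> in_range (Re w +i* k)%C.
  move=> kh; apply: circ; apply/eqP; rewrite -sqrp_eq1 ?normc_ge0 // normc_sqr /=.
  by rewrite kh h2 addrC subrK.
have Ih : `|Im w| <= h.
  by rewrite -ler_sqr ?nnegrE // real_normK ?num_real //; lra.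
have [hz|hn] := eqVneq h 0.
  have I0 : Im w = 0 by apply/eqP; rewrite -normr_eq0 eq_le normr_ge0 andbT -hz.
  by have := Wc (Im w); rewrite I0 hz => /(_ erefl); case: w I0 {w1 h w2 h0 h2 Wc Ih hz} => p q /= ->.
have hp : 0 < h by rewrite lt_neqAle eq_sym hn.
pose t := (Im w + h) / (2 * h).
move: Ih; rewrite ler_norml => /andP[I1 I2].
have t0 : 0 <= t by rewrite divr_ge0 ?mulr_ge0 //; lra.
have t1 : t <= 1 by rewrite ler_pdivrMr ?mulr_gt0 //; lra.
have := numerical_range_convex (Wc (- h) ltac:(by rewrite sqrrN)) (Wc h erefl) t0 t1.
have -> // : (1 - t)%:C * (Re w +i* - h)%C + t%:C * (Re w +i* h)%C = w.
apply: complex_ext => /=; rewrite ?mul0r ?subr0 ?addr0 /=; first by ring.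
by rewrite /t; field.
Qed.

End NumericalRangeConvex.

(** * The theorem for a complete semi-inner product *)

Section DiscRange.
Variables (R : realType) (V : lmodType R[i]) (g : V -> V -> R[i]).
Hypotheses (gP : semi_inner g) (gcomp : nm_complete g).
Local Notation nm := (snm g).

Lemma numerical_range_disc (T N N' K : V -> V) (Z : set R[i]) :
  lin T -> bdd g T -> lin N -> bdd g N -> lin N' -> bdd g N' ->
  lin K -> bdd g K -> compact_op g K ->
  (forall x y, g (N x) y = g x (N' y)) ->
  (forall x, nm (N' (N x) - N (N' x)) = 0) ->
  (forall x, T x = N x + K x) ->
  (forall l : R[i], 1 <= normc l -> exists F e, 0 < e /\
     forall x, orth g x F -> nm x = 1 -> e < nm (N x - l *: x)) ->
  (forall x, normc (g (T x) x) <= nm x ^+ 2) ->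
  infinite_set Z ->
  (forall z, Z z -> normc z = 1 /\ forall e, 0 < e ->
     exists x, nm x = 1 /\ normc (g (T x) x - z) < e) ->
  forall w, normc w <= 1 -> in_range g T w.
Proof.
move=> Tl Tb Nl Nb N'l N'b Kl Kb Kc NN' Nn TNK reg rad Zinf ZP.
have [F0 [r0 [r00 r01 F0P]]] := essential_contraction gP Nl N'l Nb N'b NN' Nn reg.
have e0 : 0 < (1 - r0) / 2 by rewrite divr_gt0 // subr_gt0.
have [F1 F1P] := compact_small gP gcomp Kl Kb Kc e0.
have [E [EO EF]] := orthonormal_exists gP (F0 ++ F1).
pose r := (1 + r0) / 2.
have r1 : r < 1 by rewrite /r; lra.
have Er x : orth g x E -> normc (g (T x) x) <= r * nm x ^+ 2.
  move=> /EF/orth_cat[/F0P h0 /F1P h1].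
  rewrite expr2 mulrA; apply: le_trans (cauchy_schwarz gP _ _) _.
  apply: ler_wpM2r; first exact: nm_ge0.
  rewrite TNK; apply: le_trans (nmD_le gP _ _) _; rewrite /r; lra.
have [f [fan fker fbig]] := contact_determinant gP gcomp Tl Tb rad EO r1 Er.
(* Otherwise the contact form is at least c on unit vectors, whereas at x it is -Re (conj z (g (T x)
   x - z)), which is below c once the value is within c of z. *)
have fZ z : Z z -> f z = 0.
  move=> /ZP[z1 zW]; apply: contrapT => /(fbig z z1)[c c0 cP].
  have [x [x1 xz]] := zW _ c0.
  have := cP x; rewrite x1 expr1n mulr1 (contact_form_diag gP) x1 expr1n.
  have -> : z^* * g (T x) x = 1 + z^* * (g (T x) x - z).
    by rewrite mulrBr [z^* * z]mulrC unit_conj // addrC subrK.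
  rewrite ReD /=; have := normc_Re_ge (z^* * (g (T x) x - z)).
  by rewrite normcM normc_conj z1 mul1r; lra.
have [z0 [z01 z0P]] := circle_limit_point Zinf (fun z Zz => (ZP z Zz).1).
have acc : zeros_cluster f z0.
  move=> e /z0P[z [Zz zd]]; exists z; split=> //; last exact: fZ.
  by have [] := ZP z Zz.
have f0 := circle_identity fan z01 acc.
apply: (circle_range_disc gP Tl Tb) => z z1.
have [x [x1 xk]] := fker z z1 (f0 z z1); exists x; split=> //.
have h1 : Re (z^* * g (T x) x) = 1.
  have := contact_form_diag gP T z x; rewrite xk x1 expr1n /=; lra.
have h2 : normc (z^* * g (T x) x) <= 1.
  by rewrite normcM normc_conj z1 mul1r; have := rad x; rewrite x1 expr1n.
(* Real part 1 and modulus at most 1 leave no imaginary part. *)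
have h3 : z^* * g (T x) x = 1.
  apply: complex_ext => //=; apply/eqP; rewrite -sqrf_eq0.
  have := normc_sqr (z^* * g (T x) x); rewrite h1.
  have : normc (z^* * g (T x) x) ^+ 2 <= 1 by rewrite expr_le1 ?normc_ge0.
  have := sqr_ge0 (Im (z^* * g (T x) x)); move: (Im _ ^+ 2) => q.
  by rewrite expr1n => q0 h4 h5; rewrite eq_le q0 andbT; lra.
by rewrite -[LHS]mul1r -(unit_conj z1) -mulrA h3 mulr1.
Qed.

End DiscRange.

(** * The semi-inner product of a positive operator *)

Section PlaneTopology.
Variable R : realType.

Lemma nbhs_disc (z : R[i]^o) (e : R) : 0 < e ->
  nbhs z [set w : R[i]^o | normc (w - z) < e].
Proof.
move=> e0; have e0' : (0 : R[i]) < e%:C by rewrite ltcR.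
apply: filterS (nbhsx_ballx z e%:C e0') => w.
by rewrite /ball /= distrC normcE_norm ltcR.
Qed.

Lemma closure_approx (S : set R[i]^o) z (e : R) : closure S z -> 0 < e ->
  exists w : R[i], S w /\ normc (w - z) < e.
Proof. by move=> Sz e0; have [w [Sw wz]] := Sz _ (nbhs_disc z e0); exists w. Qed.

Lemma closure_unit_disc (z : R[i]) : closure (@unit_disc R) z -> normc z <= 1.
Proof.
move=> zD; apply/ler_addgt0Pr => e e0.
have [w [w1 wz]] := closure_approx zD e0.
have {}w1 : normc w < 1 by rewrite -ltcR -normcE_norm.
have := normcB_le w (w - z); rewrite subKr; lra.
Qed.

Lemma boundary_unit_disc (z : R[i]) : boundary (@unit_disc R) z -> normc z = 1.
Proof.
move=> [zD zI]; apply/eqP; rewrite eq_le closure_unit_disc //= leNgt.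
apply/negP => z1; apply: zI.
apply: filterS (nbhs_disc z (_ : 0 < 1 - normc z)); last by rewrite subr_gt0.
move=> w /= wz; rewrite /unit_disc /= normcE_norm ltcR.
have := normcD_le (w - z) z; rewrite subrK; lra.
Qed.

Lemma cvg0_normc (u : nat -> R[i]) : ((u : nat -> R[i]^o) @ \oo --> (0 : R[i]^o)) ->
  forall e : R, 0 < e -> exists n0, forall n, (n0 <= n)%N -> normc (u n) <= e.
Proof.
move=> u0 e e0; have [n0 _ h] := u0 _ (nbhs_disc 0 e0).
by exists n0 => n /h /=; rewrite subr0 => /ltW.
Qed.

End PlaneTopology.

Section SemiHilbert.
Variables (R : realType) (H : completeNormedModType R[i]).
Variable ip : {dot H for @Num.conj R[i]}.
Hypothesis H_hilbert : induces_norm ip.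

Lemma ip_semi_inner : semi_inner (fun x y => ip x y).
Proof.
split=> [a x y z|x y|x].
- exact: linearPl.
- by rewrite (hermC ip) expr0 mul1r.
- by rewrite -H_hilbert exprn_ge0.
Qed.

Local Notation nip := (snm (fun x y : H => ip x y)).

Lemma norm_ip (x : H) : `|x| = (nip x)%:C.
Proof.
apply/eqP; rewrite -(@eqrXn2 _ 2) ?ler0c ?nm_ge0 // H_hilbert.
by rewrite (gxxE ip_semi_inner) rmorphXn.
Qed.

Lemma bounded_ip (B : H -> H) : bounded_op B ->
  lin B /\ exists2 M : R, 0 <= M & forall x, nip (B x) <= M * nip x.
Proof.
move=> [Bl [M BM]]; split=> //; exists (normc M); first exact: normc_ge0.
move=> x; have := BM x; rewrite !norm_ip => h.
have h2 : (nip (B x))%:C <= `|M * (nip x)%:C|.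
  by rewrite ger0_norm //; apply: le_trans h; rewrite ler0c nm_ge0.
move: h2; rewrite normcE_norm lecR normcM normcC ger0_norm ?nm_ge0 //.
Qed.

Variable A : H -> H.
Hypothesis A_pos : positive_op ip A.
Local Notation g := (ipA ip A).
Local Notation nm := (snm g).

(** Hermitian symmetry comes by polarisation, from the reality of the form at x + y and i x + y. *)
Lemma ipA_semi_inner : semi_inner g.
Proof.
have iP := ip_semi_inner; have [[Al _] A0] := A_pos.
have gl a x y z : g (a *: x + y) z = a * g x z + g y z.
  by rewrite /ipA Al (gPl iP).
split=> // x y.
have real z : Im (g z z) = 0 by exact: ger0_Im (A0 z).
have h1 := real (1 *: x + y); have h2 := real ('i%C *: x + y).
rewrite gl /ipA !(gDr iP) !(gZr iP) -!/(g _ _) in h1.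
rewrite gl /ipA !(gDr iP) !(gZr iP) -!/(g _ _) in h2.
have hx := real x; have hy := real y.
move: h1 h2 hx hy; rewrite /ipA.
case: (ip (A x) x) => a1 a2; case: (ip (A x) y) => b1 b2.
case: (ip (A y) x) => c1 c2; case: (ip (A y) y) => d1 d2 /= h1 h2 hx hy.
by apply: complex_ext => /=; lra.
Qed.

Let iP := ip_semi_inner.
Let gP := ipA_semi_inner.

Lemma ipA_adj x y : ip (A x) y = ip x (A y).
Proof. by rewrite -[LHS]/(g x y) (gC gP) -(gC iP). Qed.

Lemma nm_A0 x : A x = 0 -> nm x = 0.
Proof. by move=> Ax; apply: nm_null => y; rewrite /ipA Ax (g0l iP). Qed.

Lemma normA_nm x : normA ip A x = (nm x)%:C.
Proof.
by rewrite /normA (gxxE gP) rmorphXn /= sqrCK // ler0c nm_ge0.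
Qed.

(** |A x|^2 is the A-product of x with A x, so at most |x|_A |A x|_A, and |A x|_A <= sqrt M |A x|.
    Thus [A] maps Cauchy sequences of the semi-norm to Cauchy sequences of the norm. *)
Lemma nip_A_le : exists2 c : R, 0 <= c & forall x, nip (A x) <= c * nm x.
Proof.
have [[Al _] _] := A_pos; have [_ [M M0 AM]] := bounded_ip A_pos.1.
exists (Num.sqrt M); first exact: sqrtr_ge0.
move=> x; have a0 := nm_ge0 (fun x y => ip x y) (A x).
have h1 : nip (A x) ^+ 2 <= nm x * nm (A x).
  rewrite (nm_sqr iP); apply: le_trans (Re_le_normc _) _.
  exact: cauchy_schwarz gP x (A x).
have h2 : nm (A x) <= Num.sqrt M * nip (A x).
  rewrite -ler_sqr ?nnegrE ?nm_ge0 ?mulr_ge0 ?sqrtr_ge0 // exprMn (sqr_sqrtr M0).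
  rewrite (nm_sqr gP); apply: le_trans (Re_le_normc _) _.
  apply: le_trans (cauchy_schwarz iP _ _) _.
  by rewrite expr2 mulrA ler_wpM2r.
have [->|an] := eqVneq (nip (A x)) 0; first by rewrite mulr_ge0 ?sqrtr_ge0 ?nm_ge0.
have ap : 0 < nip (A x) by rewrite lt_neqAle eq_sym an.
rewrite -(ler_pM2r ap) -expr2; apply: le_trans h1 _.
by rewrite mulrAC [leRHS]mulrC ler_wpM2l ?nm_ge0.
Qed.

(* If [A u_n -> A x], then [<A (u_n - x), w> = lim_m <A (u_n - u_m), w>] is at
   most [e |w|_A]; take [w = u_n - x]. *)
Lemma ipA_complete : closed (range A) -> nm_complete g.
Proof.
move=> Acl u uC; have [c c0 Ac] := nip_A_le; have Al := A_pos.1.1.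
have Aucvg : cvg ((A \o u) @ \oo).
  apply/cauchy_cvgP/cauchy_exP => e e0.
  have eE : e = (Re e)%:C by rewrite RRe_real // gtr0_real.
  have re0 : 0 < Re e by rewrite -ltcR -eE.
  have d0 : 0 < Re e / (c + 1) by rewrite divr_gt0 //; lra.
  have [n0 n0P] := uC _ (divr_gt0 d0 (ltr0Sn R 1)).
  exists (A (u n0)); exists n0 => // n /= hn.
  rewrite -ball_normE /ball_ /= eE -(linB Al) norm_ip ltcR.
  apply: le_lt_trans (Ac _) _.
  have h := n0P n0 n (leqnn _) hn; have nm0' := nm_ge0 g (u n0 - u n).
  have h2 : (c + 1) * nm (u n0 - u n) <= Re e / 2.
    have c1 : 0 <= c + 1 by lra.
    apply: le_trans (ler_wpM2l c1 h) _.
    have -> // : (c + 1) * (Re e / (c + 1) / 2) = Re e / 2.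
    by field; rewrite gt_eqF //; lra.
  lra.
have /cvg_ex[y yP] := Aucvg.
have [x _ Axy] : range A y.
  by apply: (closed_cvg (range A) Acl _ y yP); apply: nearW => n; exists (u n).
exists x => e e0; have [n0 n0P] := uC e e0.
exists n0 => n hn.
have key : nm (u n - x) ^+ 2 <= e * nm (u n - x).
  apply/ler_addgt0Pr => d d0.
  set w := u n - x.
  have W0 : 0 < nip w + 1 by have := nm_ge0 (fun x y => ip x y) w; lra.
  have [m1 [m1P m1n]] : exists m1, nip (A (u m1) - A x) <= d / (nip w + 1) /\ (n0 <= m1)%N.
    have d0' : 0 < (d / (nip w + 1))%:C by rewrite ltcR divr_gt0.
    have [m1 _ m1P] := cvgr_dist_lt _ _ yP _ d0'.
    exists (maxn n0 m1); split; last exact: leq_maxl.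
    have := m1P (maxn n0 m1) (leq_maxr _ _); rewrite /= -Axy distrC norm_ip ltcR.
    exact: ltW.
  have -> : nm w ^+ 2 = Re (g ((u n - u m1) + (u m1 - x)) w).
    by rewrite (nm_sqr gP) addrA subrK.
  rewrite (gDl gP) ReD; apply: lerD.
    apply: le_trans (Re_le_normc _) _; apply: le_trans (cauchy_schwarz gP _ _) _.
    by rewrite ler_wpM2r ?nm_ge0 // n0P.
  apply: le_trans (Re_le_normc _) _; rewrite /ipA (linB Al).
  apply: le_trans (cauchy_schwarz iP _ _) _.
  apply: le_trans (_ : d / (nip w + 1) * (nip w + 1) <= _); last first.
    by rewrite divfK // gt_eqF.
  by apply: ler_pM; rewrite ?nm_ge0 // lerDl.
have w0 := nm_ge0 g (u n - x).
have [->|wn] := eqVneq (nm (u n - x)) 0; first exact: ltW.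
by move: key; rewrite expr2 ler_pM2r // lt_neqAle eq_sym wn.
Qed.

Lemma in_BA12_bdd (T : H -> H) : in_BA12 ip A T -> lin T /\ bdd g T.
Proof.
move=> [[Tl _] [c [c0 h]]]; split=> //; exists (Re c).
  by have := ltW c0; rewrite lecE => /andP[].
move=> x; have := h x; rewrite !normA_nm.
have cE : c = (Re c)%:C by rewrite RRe_real // gtr0_real.
by rewrite {1}cE -rmorphM lecR.
Qed.

Lemma A_compact_op (K : H -> H) : A_compact ip A K -> compact_op g K.
Proof.
move=> [_ Kc] u [B uB].
have [|f [y [fmono fP]]] := Kc u.
  by exists B%:C => n; rewrite normA_nm lecR.
exists f, y; split=> // e e0; have [n0 n0P] := cvg0_normc fP e0.
exists n0 => n /n0P; rewrite normA_nm normcC ger0_norm ?nm_ge0 //.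
Qed.

Lemma numerical_rangeP (T : H -> H) z :
  A_numerical_range ip A T z <-> in_range g T z.
Proof.
split=> -[x [x1 xz]]; exists x; split=> //.
  by apply: complexI; rewrite -normA_nm.
by rewrite normA_nm x1.
Qed.

End SemiHilbert.

Theorem theorem3p7 (R : realType) (H : completeNormedModType R[i])
  (ip : {dot H for @Num.conj R[i]})
  (H_hilbert : induces_norm ip)
  (H_separable : separable H)
  (H_infdim : infinite_dimensional H)
  (A : H -> H)
  (A_pos : positive_op ip A)
  (A_neq0 : exists x, A x <> 0)
  (A_closed : closed (range A))
  (T N K : H -> H)
  (T_BA12 : in_BA12 ip A T)
  (T_decomp : forall x, T x = N x + K x)
  (N_normal : A_normal ip A N)
  (K_compact : A_compact ip A K)
  (W_sub : A_numerical_range ip A T `<=` closure (@unit_disc R))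
  (ess_sub : A_ess_spectrum ip A T `<=` @unit_disc R)
  (W_infinite : infinite_set
     (closure (A_numerical_range ip A T) `&` boundary (@unit_disc R))) :
  A_numerical_range ip A T = closure (@unit_disc R).
Proof.
pose g := ipA ip A.
have gP : semi_inner g := ipA_semi_inner H_hilbert A_pos.
have gcomp : nm_complete g := ipA_complete H_hilbert A_pos A_closed.
have rangeP := numerical_rangeP H_hilbert A_pos T.
have [Tl Tb] := in_BA12_bdd H_hilbert A_pos T_BA12.
have [Kl Kb] := in_BA12_bdd H_hilbert A_pos K_compact.1.
have Kc := A_compact_op H_hilbert A_pos K_compact.
have [[[Nl _] _] [N' [[[N'l _] [Ns [[_ NNs] AN']] _] normal]]] := N_normal.
have NN' x y : g (N x) y = g x (N' y).
  have h := ipA_adj H_hilbert A_pos; rewrite /g /ipA !h NNs.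
  by rewrite -[Ns (A y)]/((Ns \o A) y) -AN'.
have N'N x : snm g (N' (N x) - N (N' x)) = 0.
  apply: (nm_A0 H_hilbert); rewrite (linB A_pos.1.1).
  have /= -> := congr1 (fun f => f x) normal; exact: subrr.
(* The bound in the A-semi-norm is inherited from N = T - K. *)
have Nb : bdd g N.
  have [[c c0 Tc] [k k0 Kk]] := (Tb, Kb); exists (c + k); first exact: addr_ge0.
  move=> x; have -> : N x = T x - K x by rewrite T_decomp addrK.
  by apply: le_trans (nmB_le gP _ _) _; rewrite mulrDl lerD.
(* By normality N and N' have equal A-semi-norms at each vector. *)
have N'b : bdd g N'.
  have [c c0 Nc] := Nb; exists c => // x; suff -> : snm g (N' x) = snm g (N x) by [].
  apply/eqP; rewrite -(@eqrXn2 _ 2) ?nm_ge0 // !(nm_sqr gP) NN'.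
  have -> : g (N' x) (N' x) = (g x (N (N' x)))^*.
    by rewrite -(gC gP) NN'.
  have := g_null gP x (N'N x); rewrite (gBl gP) => /eqP; rewrite subr_eq0 => /eqP h.
  by rewrite ReJ (gC gP (N' (N x))) h -(gC gP).
have rad x : normc (g (T x) x) <= snm g x ^+ 2.
  have [x0|x0] := eqVneq (snm g x) 0.
    by rewrite x0 expr0n (gC gP) (g_null gP) // conjC0 normc0.
  have := closure_unit_disc (W_sub _ ((rangeP _).2
    (ex_intro _ _ (conj (normalize gP x0) erefl)))).
  rewrite -/g (linZ Tl) (gZl gP) (gZr gP) conj_realC mulrA -rmorphM /= -expr2 exprVn.
  rewrite normcM normcC ger0_norm ?invr_ge0 ?sqr_ge0 // mulrC ler_pdivrMr ?mul1r //.
  by rewrite exprn_even_gt0.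
(* Such an l is outside the essential spectrum; the left parametrix of T - l bounds N - l below. *)
have reg (l : R[i]) : 1 <= normc l -> exists F e, 0 < e /\
    forall x, orth g x F -> snm g x = 1 -> e < snm g (N x - l *: x).
  move=> l1; have : ~ A_ess_spectrum ip A T l.
    by move/ess_sub; rewrite /unit_disc /= normcE_norm ltcR ltNge l1.
  move=> /contrapT[_ [S [K1 [K2 [/(in_BA12_bdd H_hilbert A_pos)[_ Sb] _ K2c _ ST]]]]].
  have [K2l K2b] := in_BA12_bdd H_hilbert A_pos K2c.1.
  apply: (fredholm_bounded_below gP gcomp Kl Kb Kc K2l K2b
    (A_compact_op H_hilbert A_pos K2c) Sb T_decomp) => x.
  by apply: (nm_A0 H_hilbert); rewrite !(linB A_pos.1.1) ST subrr.
have disc := numerical_range_disc gP gcomp Tl Tb Nl Nb N'l N'b Kl Kb Kc NN' N'N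
  T_decomp reg rad W_infinite.
apply/seteqP; split=> // w /closure_unit_disc w1; apply/rangeP/disc => // z.
move=> [zW /boundary_unit_disc z1]; split=> // e e0.
have [v [/rangeP[x [x1 xv]] vz]] := closure_approx zW e0.
by exists x; rewrite /g xv.
Qed.
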